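(* Let $\Phi\in\{E_6,E_7,E_8,F_4,G_2\}$, of rank $\ell$ with Coxeter number $h$ and generalized Eulerian polynomial $R_\Phi(x)=\sum_{i=1}^{h-1}a_ix^i$. Let $g(t)\in\mathbb{R}[t]$ be a real polynomial of degree $\ell$ satisfying $g(t-h)=(-1)^\ell g(-t)$. Then there exists $m_1$ such that for every integer $m\geq m_1$, every root $\alpha\in\mathbb{C}$ of the equation \[ (R_\Phi(S^{m+1})g)(t)=\sum_{i=1}^{h-1}a_i\,g(t-(m+1)i)=0 \] satisfies $\operatorname{Re}\alpha=\frac{mh}{2}$.
   Context: For an irreducible root system $\Phi$ of rank $\ell$ with positive system $\Phi^+$, simple roots $\alpha_1,\dots,\alpha_\ell$, Weyl group $W$, Coxeter number $h$, highest root $\widetilde\alpha=\sum_{i=1}^\ell c_i\alpha_i$, $\alpha_0:=-\widetilde\alpha$, $c_0:=1$, and index of connection $f$ (index of the coroot lattice in the coweight lattice), define $\operatorname{asc}(w)=\sum_{0\le i\le\ell,\ w(\alpha_i)\in\Phi^+}c_i$ for $w\in W$, and the generalized Eulerian polynomial $R_\Phi(x)=\frac1f\sum_{w\in W}x^{\operatorname{asc}(w)}$, a polynomial of degree $h-1$ with zero constant term. The shift operator $S$ acts by $(S\varphi)(t)=\varphi(t-1)$, and a polynomial $\sigma(S)=\sum_k b_kS^k$ acts by $(\sigma(S)\varphi)(t)=\sum_k b_k\varphi(t-k)$. *)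

(* Defs.v *)
From mathcomp Require Import all_boot all_order all_fingroup all_algebra.
From mathcomp Require Import finmap.
From mathcomp Require Import boolp classical_sets cardinality reals.
From mathcomp Require Import complex.

Set Implicit Arguments.
Unset Strict Implicit.
Unset Printing Implicit Defensive.

Import Order.TTheory GRing.Theory Num.Theory.
Local Open Scope ring_scope.

Definition dot (R : realType) (l : nat) (a b : 'rV[R]_l) : R :=
  (a *m b^T) 0 0.

(* <b, a^vee> = 2 (b, a) / (a, a) *)
Definition pairing (R : realType) (l : nat) (b a : 'rV[R]_l) : R :=
  2 * dot b a / dot a a.

Definition coroot (R : realType) (l : nat) (a : 'rV[R]_l) : 'rV[R]_l :=
  (2 / dot a a) *: a.

Definition reflection (R : realType) (l : nat) (a b : 'rV[R]_l) : 'rV[R]_l :=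
  b - pairing b a *: a.

Lemma dot_eq0 (R : realType) (l : nat) (a : 'rV[R]_l) :
  (dot a a == 0) = (a == 0).
Proof.
apply/eqP/eqP => [|->]; last by rewrite /dot mul0mx mxE.
rewrite /dot mxE => /eqP; rewrite psumr_eq0 => [/allP a0|i _]; last first.
  by rewrite mxE -expr2 sqr_ge0.
apply/rowP => i; rewrite mxE; apply/eqP.
by have := a0 i (mem_index_enum i); rewrite mxE mulf_eq0 orbb.
Qed.

Lemma reflection_self (R : realType) (l : nat) (a : 'rV[R]_l) :
  a != 0 -> reflection a a = - a.
Proof.
rewrite -dot_eq0 => n0.
by rewrite /reflection /pairing mulfK // scaler_nat mulr2n opprD addNKr.
Qed.

Lemma reflectionK (R : realType) (l : nat) (a : 'rV[R]_l) :
  involutive (reflection a).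
Proof.
move=> b; have [->|a0] := eqVneq a 0.
  by rewrite /reflection !scaler0 !subr0.
have pB u v : pairing (u - v) a = pairing u a - pairing v a.
  by rewrite /pairing /dot mulmxBl !mxE mulrBr mulrBl.
have pZ k v : pairing (k *: v) a = k * pairing v a.
  by rewrite /pairing /dot -scalemxAl !mxE -!mulrA mulrCA.
have pa : pairing a a = 2 by rewrite /pairing mulfK // dot_eq0.
rewrite {1}/reflection {1}/reflection pB pZ pa -addrA -opprD -scalerDl.
by rewrite mulr_natr mulr2n opprD addNKr subrr scale0r subr0.
Qed.

(* A reduced crystallographic root system of rank l; since the roots span the
   ambient Euclidean space, the latter is R^l with the standard dot product. *)
Record rootSystem (R : realType) (l : nat) := RootSystem {
  roots :> {fset 'rV[R]_l};
  root_neq0 : forall a : 'rV[R]_l, a \in roots -> a != 0;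
  root_span : <<enum_fset roots>>%VS = fullv;
  root_reflection : forall a b : 'rV[R]_l,
    a \in roots -> b \in roots -> reflection a b \in roots;
  root_crystallographic : forall a b : 'rV[R]_l,
    a \in roots -> b \in roots -> pairing b a \is a Num.int;
  root_reduced : forall (a : 'rV[R]_l) (k : R),
    a \in roots -> k *: a \in roots -> k = 1 \/ k = -1
}.

Lemma root_opp (R : realType) (l : nat) (Phi : rootSystem R l) (a : Phi) :
  - val a \in roots Phi.
Proof.
rewrite -(reflection_self (root_neq0 (valP a))).
exact: root_reflection (valP a) (valP a).
Qed.

Definition opp_root (R : realType) (l : nat) (Phi : rootSystem R l) (a : Phi) :
  Phi := [` root_opp a]%fset.

Definition root_refl (R : realType) (l : nat) (Phi : rootSystem R l)
  (a b : Phi) : Phi := [` root_reflection (valP a) (valP b)]%fset.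

Lemma root_refl_inj (R : realType) (l : nat) (Phi : rootSystem R l) (a : Phi) :
  injective (root_refl a).
Proof.
move=> b c /(congr1 val) /= bc; apply/val_inj.
exact: (can_inj (reflectionK (val a)) bc).
Qed.

Definition refl_perm (R : realType) (l : nat) (Phi : rootSystem R l) (a : Phi) :
  {perm Phi} := perm (@root_refl_inj R l Phi a).

(* The roots span the space, so the Weyl group acts faithfully on them and is
   represented by its image in the symmetric group of the set of roots. *)
Definition weyl (R : realType) (l : nat) (Phi : rootSystem R l) :
  {set {perm Phi}} := <<[set refl_perm a | a : Phi]>>%g.

Definition ncomb (R : realType) (l : nat) (alpha : 'I_l -> 'rV[R]_l)
  (k : 'I_l -> nat) : 'rV[R]_l := \sum_i (k i)%:R *: alpha i.

Record base (R : realType) (l : nat) (Phi : rootSystem R l) := Base {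
  simple :> 'I_l -> Phi;
  base_free : free [seq val (simple i) | i : 'I_l];
  base_sign : forall b : Phi, exists k : 'I_l -> nat,
    val b = ncomb (val \o simple) k \/ val b = - ncomb (val \o simple) k
}.

Definition positive (R : realType) (l : nat) (Phi : rootSystem R l)
  (Delta : base Phi) (b : Phi) : bool :=
  `[< exists k : 'I_l -> nat, val b = ncomb (val \o Delta) k >].

Definition is_highest_root (R : realType) (l : nat) (Phi : rootSystem R l)
  (Delta : base Phi) (theta : Phi) (c : 'I_l -> nat) : Prop :=
  val theta = ncomb (val \o Delta) c /\
  forall b : Phi, exists k : 'I_l -> nat,
    val theta - val b = ncomb (val \o Delta) k.

Definition coxeter_number (R : realType) (l : nat) (Phi : rootSystem R l)
  (Delta : base Phi) : nat :=
  #[\prod_(i < l) refl_perm (Delta i)]%g.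

Definition coroot_lattice (R : realType) (l : nat) (Phi : rootSystem R l) :
  set 'rV[R]_l :=
  [set v | exists z : Phi -> int,
             v = \sum_(a : Phi) coroot (val a) *~ z a]%classic.

Definition coweight_lattice (R : realType) (l : nat) (Phi : rootSystem R l) :
  set 'rV[R]_l :=
  [set v | forall a : Phi, dot v (val a) \is a Num.int]%classic.

Definition is_index_of_connection (R : realType) (l : nat)
  (Phi : rootSystem R l) (f : nat) : Prop :=
  ([set ((fun q => (v + q)%R) @` coroot_lattice Phi)
     | v in coweight_lattice Phi]%classic #= `I_f)%card.

(* Index 0 stands for alpha_0 = - theta with c_0 = 1, and i.+1 for the i-th
   simple root. *)
Definition ext_root (R : realType) (l : nat) (Phi : rootSystem R l)
  (Delta : base Phi) (theta : Phi) (i : 'I_l.+1) : Phi :=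
  if unlift ord0 i is Some j then Delta j else opp_root theta.

Definition ext_coef (l : nat) (c : 'I_l -> nat) (i : 'I_l.+1) : nat :=
  if unlift ord0 i is Some j then c j else 1%N.

Definition asc (R : realType) (l : nat) (Phi : rootSystem R l)
  (Delta : base Phi) (theta : Phi) (c : 'I_l -> nat) (w : {perm Phi}) : nat :=
  (\sum_(i < l.+1 | positive Delta (w (ext_root Delta theta i)))
     ext_coef c i)%N.

Definition gen_eulerian (R : realType) (l : nat) (Phi : rootSystem R l)
  (Delta : base Phi) (theta : Phi) (c : 'I_l -> nat) (f : nat) : {poly R} :=
  f%:R^-1 *: \sum_(w in weyl Phi) 'X^(asc Delta theta c w).

(* (sigma(S) phi)(t), where (S phi)(t) = phi (t - 1) *)
Definition shift_op (K : nzRingType) (sigma : {poly K}) (phi : K -> K) (t : K) :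
  K := \sum_(k < size sigma) sigma`_k * phi (t - k%:R).

Variant exceptional := E6 | E7 | E8 | F4 | G2.

Definition rank_of (X : exceptional) : nat :=
  match X with E6 => 6 | E7 => 7 | E8 => 8 | F4 => 4 | G2 => 2 end.

(* Bourbaki's numbering of the simple roots; the (i, j) entry is
   <alpha_i, alpha_j^vee>. *)
Definition cartan_rows (X : exceptional) : seq (seq int) :=
  match X with
  | E6 => [:: [:: 2;  0; -1;  0;  0;  0];
              [:: 0;  2;  0; -1;  0;  0];
              [::-1;  0;  2; -1;  0;  0];
              [:: 0; -1; -1;  2; -1;  0];
              [:: 0;  0;  0; -1;  2; -1];
              [:: 0;  0;  0;  0; -1;  2]]
  | E7 => [:: [:: 2;  0; -1;  0;  0;  0;  0];
              [:: 0;  2;  0; -1;  0;  0;  0];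
              [::-1;  0;  2; -1;  0;  0;  0];
              [:: 0; -1; -1;  2; -1;  0;  0];
              [:: 0;  0;  0; -1;  2; -1;  0];
              [:: 0;  0;  0;  0; -1;  2; -1];
              [:: 0;  0;  0;  0;  0; -1;  2]]
  | E8 => [:: [:: 2;  0; -1;  0;  0;  0;  0;  0];
              [:: 0;  2;  0; -1;  0;  0;  0;  0];
              [::-1;  0;  2; -1;  0;  0;  0;  0];
              [:: 0; -1; -1;  2; -1;  0;  0;  0];
              [:: 0;  0;  0; -1;  2; -1;  0;  0];
              [:: 0;  0;  0;  0; -1;  2; -1;  0];
              [:: 0;  0;  0;  0;  0; -1;  2; -1];
              [:: 0;  0;  0;  0;  0;  0; -1;  2]]
  | F4 => [:: [:: 2; -1;  0;  0];
              [::-1;  2; -2;  0];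
              [:: 0; -1;  2; -1];
              [:: 0;  0; -1;  2]]
  | G2 => [:: [:: 2; -1];
              [::-3;  2]]
  end%Z.

Definition cartan (X : exceptional) : 'M[int]_(rank_of X) :=
  \matrix_(i, j) nth 0 (nth [::] (cartan_rows X) i) j.

Definition has_type (R : realType) (X : exceptional)
  (Phi : rootSystem R (rank_of X)) (Delta : base Phi) : Prop :=
  forall i j : 'I_(rank_of X),
    pairing (val (Delta i)) (val (Delta j)) = (cartan X i j)%:~R.

(* Main.v *)
From Stdlib Require Import BinInt.
Require Import Defs.
From mathcomp Require Import all_boot all_order all_fingroup all_algebra.
From mathcomp Require Import cyclic finmap.
From mathcomp Require Import boolp classical_sets cardinality reals.
From mathcomp Require polyrcf.
From mathcomp Require Import ring zify ssrZ.
From mathcomp Require Import complex.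
Import Order.TTheory GRing.Theory Num.Theory.
Local Open Scope ring_scope.

Set Implicit Arguments.
Unset Strict Implicit.
Unset Printing Implicit Defensive.

(** Put n = m + 1 and t = m h / 2 + i n y. The symmetries of g and of R_Phi turn
    the shifted sum into i^l times a real polynomial in y of degree at most l
    whose value at a fixed y is a polynomial in n with leading coefficient
    g_l T(y), where T(y) = sum_j a_j Re (y - i (h/2 - j))^l. If T changes sign l
    times, then for large n the real polynomial has l distinct real roots, hence
    no others, and every root t has real part m h / 2.

    It remains to know R_Phi up to a nonzero factor. Expanding the product over
    the nodes i of the extended diagram of 1 + [w alpha_i > 0] (x^{c_i} - 1) gives
    sum_w x^{asc w} = sum_J N_J prod_{j in J} (x^{c_j} - 1), where N_J counts the
    w with w alpha_j > 0 for all j in J. For a proper subset J every coset of the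
    reflection subgroup W_J contains exactly one such w, so N_J = |W| / |W_J|;
    and |W_J| / |W_{J - j}| is the size of the W_J-orbit of the j-th fundamental
    weight of J, a finite computation with integer vectors. The coefficients c_i
    and h are computed from the Cartan matrix in the same way. *)

(** * Roots on a line *)

(** The bound [N] is free, so that the sum for R_Phi can run over 0..h, where the reflection j -> h
    - j acts. *)
Lemma shift_op_comp_Xn (K : nzRingType) (p : {poly K}) (n N : nat) (phi : K -> K)
    (t : K) : (0 < n)%N -> (size p <= N)%N ->
  shift_op (p \Po 'X^n) phi t = \sum_(j < N) p`_j * phi (t - (n * j)%:R).
Proof.
move=> n0 pN; have widen (V : zmodType) (F : nat -> V) N1 N2 : (N1 <= N2)%N ->
    (forall k, (N1 <= k)%N -> F k = 0) -> \sum_(k < N1) F k = \sum_(k < N2) F k.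
  move=> N12 F0; rewrite (big_ord_widen N2 F N12).
  rewrite [RHS](bigID (fun k : 'I_N2 => (k < N1)%N)) /=.
  rewrite [X in _ = _ + X]big1 ?addr0 // => k.
  by rewrite -leqNgt => /F0.
(* A common bound for the indices k of the composed polynomial and for all the exponents n j. *)
pose M := (size (p \Po 'X^n) + n * N)%N.
rewrite /shift_op (widen _ (fun k => _`_k * phi (t - k%:R)) _ M) ?leq_addr //; last first.
  by move=> k sk; rewrite nth_default ?mul0r.
transitivity (\sum_(k < M) \sum_(j < N) p`_j * (((k : nat) == n * j)%N%:R * phi (t - k%:R))).
  apply: eq_bigr => k _; rewrite comp_polyE (widen _ (fun i => p`_i *: 'X^n ^+ i) _ N) //.
    rewrite coef_sum mulr_suml; apply: eq_bigr => j _.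
    by rewrite coefZ -exprM coefXn mulrA.
  by move=> i si; rewrite nth_default ?scale0r.
rewrite exchange_big; apply: eq_bigr => j _ /=.
have jM : (n * j < M)%N.
  by apply: leq_trans (leq_addl _ _); rewrite ltn_pmul2l.
rewrite (bigD1 (Ordinal jM)) //= eqxx mul1r big1 ?addr0 // => k kj.
by move: kj; rewrite -val_eqE /= => /negbTE ->; rewrite mul0r mulr0.
Qed.

Lemma horner_eventually_neg (R : realType) (p : {poly R}) (d : nat) :
  (size p <= d.+1)%N -> p`_d < 0 ->
  exists N : nat, forall n : nat, (N <= n)%N -> p.[n%:R] < 0.
Proof.
move=> sp pd.
have sp' : size p = d.+1.
  apply/eqP; rewrite eqn_leq sp /= ltnNge; apply/negP => h.
  by move: pd; rewrite nth_default // ltxx.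
have lc : 0 < lead_coef (- p) by rewrite lead_coefN /lead_coef sp' oppr_gt0.
have [x hx] := polyrcf.poly_pinfty_gt_lc lc.
exists (Num.bound x) => n xn.
have := hx n%:R; rewrite hornerN.
have -> : x <= n%:R.
  apply: le_trans (ler_norm x) _; apply: le_trans (ltW (archi_boundP _)) _ => //.
  by rewrite ler_nat; move: xn; rewrite /Num.bound normr_id.
by move=> /(_ isT) /(lt_le_trans lc); rewrite oppr_gt0.
Qed.

(** The last clause carries the induction: the roots found for the tail lie to the right of [b],
    hence differ from the one that the intermediate value theorem gives between [y] and [b]. *)
Lemma roots_of_sign_changes (R : rcfType) (p : {poly R}) (y : R) (ys : seq R) :
  path (fun a b => (a < b) && (p.[a] * p.[b] < 0)) y ys ->
  exists rs : seq R, [/\ size rs = size ys, uniq rs, all (root p) rs &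
    all (fun r => y < r) rs].
Proof.
elim: ys y => [|b ys IH] y /=; first by move=> _; exists [::].
case/andP=> /andP[yb pp] /IH [rs [srs urs rrs brs]].
have [r] := polyrcf.poly_ivtoo (ltW yb) pp; rewrite in_itv /= => /andP[yr rb] rr.
exists (r :: rs); split => /=; rewrite ?srs ?rr ?yr //.
  rewrite urs andbT; apply/negP => /(allP brs) br.
  by have := lt_trans rb br; rewrite ltxx.
by apply/allP => x /(allP brs) bx; exact: lt_trans yb bx.
Qed.

(** The l distinct real roots exhaust the degree, so [p] splits into real linear factors and its
    complex roots are among them. *)
Lemma real_rooted (R : rcfType) (p : {poly R}) (l : nat) (rs : seq R) (z : R[i]) :
  p != 0 -> (size p <= l.+1)%N -> size rs = l -> uniq rs -> all (root p) rs ->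
  root (map_poly (real_complex R) p) z -> exists r : R, z = r%:C%C.
Proof.
move=> p0 sp srs urs rrs.
have sp' : size p = (size rs).+1.
  by apply/eqP; rewrite eqn_leq (max_poly_roots p0 rrs urs) srs sp.
have ur : uniq_roots rs by rewrite uniq_rootsE.
rewrite (all_roots_prod_XsubC sp' rrs ur) map_polyZ /= rootZ; last first.
  by rewrite fmorph_eq0 lead_coef_eq0.
rewrite rmorph_prod /=.
under eq_bigr do rewrite map_polyXsubC.
rewrite -(big_map (real_complex R) predT (fun r => 'X - r%:P)) root_prod_XsubC.
by case/mapP => r _ ->; exists r.
Qed.

Section Line.
Variables (R : realType) (l h : nat) (A g : {poly R}).
Hypothesis size_g : size g = l.+1.
Hypothesis g_sym : forall t : R, g.[t - h%:R] = (-1) ^+ l * g.[- t].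
Hypothesis size_A : (size A <= h.+1)%N.
Hypothesis A_palin : forall i, (i <= h)%N -> A`_i = A`_(h - i).

Let cx : {rmorphism R -> R[i]} := real_complex R.
Let half : R := h%:R / 2.

Let halfD : h%:R = half + half. Proof. exact: splitr. Qed.

Definition line_coef (k : nat) (y : R) : R :=
  complex.Re ((- 'i%C) ^+ l *
    \sum_(j < h.+1) cx A`_j * ('i%C * cx y + cx (half - j%:R)) ^+ k).

(** Recentring: the symmetry of [g] says that [G] has the parity of l. *)
Let G : {poly R} := g \Po ('X - half%:P).

Let size_G : size G = l.+1.
Proof. by rewrite size_comp_poly2 ?size_XsubC. Qed.

Let G_opp : G \Po (- 'X) = (-1) ^+ l *: G.
Proof.
apply/eqP; rewrite -subr_eq0; apply/negPn/negP => nz.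
set p := _ - _ in nz.
have p0 (x : R) : p.[x] = 0.
  rewrite /p hornerD hornerN hornerZ !horner_comp !(hornerE, hornerX).
  have := g_sym (- x + half); have -> : - x + half - h%:R = - x - half.
    by rewrite -addrA; congr (_ + _); rewrite halfD opprD addrA subrr add0r.
  by move=> ->; rewrite opprD opprK subrr.
(* If nonzero, [p] would have the [size p] distinct roots 0, 1, 2, ..., more than its degree. *)
have := max_poly_roots (rs := [seq n%:R | n <- iota 0 (size p)]) nz.
rewrite size_map size_iota ltnn => H; apply: notF; apply: H.
  by apply/allP => x _; rewrite /root p0.
by rewrite map_inj_uniq ?iota_uniq // => a b /eqP; rewrite eqr_nat => /eqP.
Qed.

Let Gc := map_poly cx G.

(** The shifted sum at t = m h / 2 + i n y with n = m + 1, as a polynomial in y: there t - n j + h /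
    2 = n (i y + h / 2 - j). The factor (-i)^l makes it real. *)
Definition line_poly (n : nat) : {poly R[i]} :=
  ((- 'i%C) ^+ l)%:P * \sum_(j < h.+1) (cx A`_j)%:P *
    (Gc \Po ((n%:R * 'i%C) *: 'X + (n%:R * cx (half - j%:R))%:P)).

Let Gc_opp (q : {poly R[i]}) : Gc \Po (- q) = ((-1) ^+ l)%:P * (Gc \Po q).
Proof.
have -> : - q = (- 'X) \Po q by rewrite raddfN /= comp_polyX.
rewrite comp_polyA; have -> : Gc \Po - 'X = (-1) ^+ l *: Gc.
  have := congr1 (map_poly cx) G_opp.
  by rewrite map_comp_poly rmorphN /= map_polyX map_polyZ /= rmorphXn rmorphN1.
by rewrite comp_polyZ mul_polyC.
Qed.

(** Conjugation changes the sign of i, and j -> h - j that of h / 2 - j. Together they negate the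
    argument of [G], and the resulting sign (-1)^l turns i^l back into (-i)^l. *)
Let line_poly_conj n : map_poly (@conjc R) (line_poly n) = line_poly n.
Proof.
rewrite /line_poly rmorphM /= map_polyC /= rmorphXn rmorphN /=.
have -> : ((0 -i* 1)%C : R[i]) = - 'i%C by rewrite /GRing.opp /= oppr0.
rewrite opprK rmorph_sum /= !mulr_sumr.
rewrite [LHS](reindex_inj rev_ord_inj) /=; apply: eq_bigr => j _.
rewrite rmorphM /= map_polyC /= subSS -A_palin; last by rewrite -ltnS.
have cr (x : R) : (x -i* 0)%C = x%:C%C by rewrite oppr0.
rewrite cr mulrCA [RHS]mulrCA; congr (_ * _).
rewrite map_comp_poly; have -> : map_poly (@conjc R) Gc = Gc.
  by rewrite -map_poly_comp; apply: eq_map_poly => x; exact: conjc_real.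
rewrite rmorphD /= map_polyZ /= map_polyX map_polyC /=.
rewrite !rmorphM /= conjc_nat.
have -> : ((0 -i* 1)%C : R[i]) = - 'i%C by rewrite /GRing.opp /= oppr0.
rewrite ?cr.
have -> : half - (h - j)%:R = - (half - j%:R).
  rewrite natrB; last by rewrite -ltnS.
  by rewrite halfD !opprD opprK !addrA subrr add0r.
rewrite [in LHS](rmorphN cx) /= polyCN !mulrN scaleNr -opprD Gc_opp mulrA -polyCM.
by rewrite -[_%:P * _%:P]polyCM -exprMn mulrN1.
Qed.

Let line_polyE n (a : R[i]) :
  (line_poly n).[a] = (- 'i%C) ^+ l * \sum_(j < h.+1) cx A`_j *
    Gc.[n%:R * ('i%C * a + cx (half - j%:R))].
Proof.
rewrite hornerM hornerC horner_sum; congr (_ * _); apply: eq_bigr => j _.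
by rewrite hornerM hornerC horner_comp !hornerE mulrDr mulrA.
Qed.

Let coef_Gc k : Gc`_k = cx G`_k. Proof. by rewrite coef_map. Qed.
Let size_Gc : size Gc = l.+1. Proof. by rewrite size_map_poly. Qed.

Let size_line_poly n : (size (line_poly n) <= l.+1)%N.
Proof.
rewrite /line_poly mul_polyC; apply: leq_trans (size_scale_leq _ _) _.
apply: leq_trans (size_sum _ _ _) _; apply/bigmax_leqP => j _.
rewrite mul_polyC; apply: leq_trans (size_scale_leq _ _) _.
apply: leq_trans (size_comp_poly_leq _ _) _; rewrite size_Gc /= ltnS.
rewrite -[X in (_ <= X)%N]muln1 leq_mul // -subn1 leq_subLR.
apply: leq_trans (size_polyD _ _) _; rewrite geq_max.
rewrite (leq_trans (size_polyC_leq1 _)) // andbT.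
by rewrite (leq_trans (size_scale_leq _ _)) // size_polyX.
Qed.

Let line_real n := map_poly (@complex.Re R) (line_poly n).

Let line_realK n : map_poly cx (line_real n) = line_poly n.
Proof.
have cj k : conjc (line_poly n)`_k = (line_poly n)`_k.
  by rewrite -{2}(line_poly_conj n) coef_map.
apply/polyP => k; rewrite coef_map /= coef_map_id0 //.
move: (cj k); case: (_`_k) => a b [] /eqP; rewrite eq_sym -addr_eq0 -mulr2n.
by rewrite mulrn_eq0 /= => /eqP ->.
Qed.

Let line_real_horner n (y : R) :
  (line_real n).[y] = (\poly_(k < l.+1) (G`_k * line_coef k y)).[n%:R].
Proof.
have -> : (line_real n).[y] = complex.Re (line_poly n).[cx y].
  by rewrite -line_realK horner_map.
rewrite line_polyE horner_poly.
under eq_bigr => j _.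
  rewrite horner_coef size_Gc mulr_sumr.
  under eq_bigr do rewrite coef_Gc exprMn mulrCA mulrA.
  over.
rewrite exchange_big /= mulr_sumr raddf_sum; apply: eq_bigr => k _ /=.
have -> : \sum_(i < h.+1) cx G`_k * cx A`_i * (n%:R ^+ k *
     ('i%C * cx y + cx (half - i%:R)) ^+ k) =
   cx (G`_k * n%:R ^+ k) * \sum_(j < h.+1) cx A`_j *
     ('i%C * cx y + cx (half - j%:R)) ^+ k.
  rewrite mulr_sumr; apply: eq_bigr => j _.
  by rewrite rmorphM rmorphXn rmorph_nat -!mulrA [cx A`_j * _]mulrCA.
rewrite mulrCA mulrAC /line_coef.
have ReZ (x : R) (w : R[i]) : complex.Re (cx x * w) = x * complex.Re w.
  by case: w => u v; rewrite /= mul0r subr0.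
by rewrite ReZ.
Qed.

Lemma roots_on_line (y : R) (ys : seq R) :
  (0 < l)%N -> size ys = l ->
  path (fun a b => (a < b) && (line_coef l a * line_coef l b < 0)) y ys ->
  exists m1 : nat, forall m : nat, (m1 <= m)%N ->
    forall alpha : R[i],
      shift_op (map_poly (real_complex R) A \Po 'X^(m.+1))
        (horner (map_poly (real_complex R) g)) alpha = 0 ->
      complex.Re alpha = m%:R * h%:R / 2.
Proof.
move=> l0 sys ysP.
pose K (a : R) := \poly_(k < l.+1) (G`_k * line_coef k a).
have Gl0 : G`_l != 0.
  by have := lead_coef_eq0 G; rewrite /lead_coef size_G /= => ->; rewrite -size_poly_eq0 size_G.
have ev : exists N : nat, forall n : nat, (N <= n)%N ->
    path (fun a b => (a < b) && ((line_real n).[a] * (line_real n).[b] < 0)) y ys.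
  elim: {sys} ys y ysP => [|b ys IH] a /=; first by exists 0%N.
  case/andP=> /andP[ab sab] /IH [N1 hN1].
  (* As a polynomial in n, the product of the values at [a] and [b] has degree at most 2l, and its
     coefficient at n^(2l) is G_l^2 T(a) T(b) < 0. *)
  have sz : (size (K a * K b)%R <= (l + l).+1)%N.
    apply: leq_trans (size_polyMleq _ _) _.
    have := leq_add (size_poly l.+1 (fun k => G`_k * line_coef k a))
      (size_poly l.+1 (fun k => G`_k * line_coef k b)).
    by rewrite -/(K a) -/(K b); case: (_ + _)%N => //= m; rewrite addSn addnS.
  have [|N2 hN2] := horner_eventually_neg sz.
    rewrite coefM (bigD1 (inord l)) //= inordK; last by rewrite ltnS leq_addr.
    rewrite addnK big1 ?addr0 => [|i].
      rewrite !coef_poly !ltnSn mulrACA -expr2 pmulr_rlt0 //.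
      by rewrite exprn_even_gt0.
    rewrite -val_eqE /= inordK ?ltnS ?leq_addr // => il; rewrite !coef_poly.
    case: ltnP => [il2|]; last by rewrite mul0r.
    case: ltnP => [il3|]; last by rewrite mulr0.
    move: il; rewrite eqn_leq -ltnS il2 /= -ltnNge => il.
    by move: il3; rewrite ltnS leq_subLR leq_add2r leqNgt il.
  exists (maxn N1 N2) => n; rewrite geq_max => /andP[/hN1 -> /hN2].
  by rewrite hornerM -!line_real_horner ab andbT.
have [N hN] := ev; exists N => m Nm alpha; rewrite (@shift_op_comp_Xn _ _ _ h.+1) //; last first.
  by rewrite size_map_poly.
pose n := m.+1; have nC : (n%:R : R[i]) != 0 by rewrite pnatr_eq0.
have iC : ('i%C : R[i]) != 0 by rewrite eq_complex /= oner_eq0 andbF.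
(* The coordinate y of [alpha], complex for now: it is a root of [line_real n], whose complex roots
   are all real. *)
pose z : R[i] := (alpha - cx (m%:R * half)) / (n%:R * 'i%C).
have alE : alpha = cx (m%:R * half) + n%:R * 'i%C * z.
  have := divfK (mulf_neq0 nC iC) (alpha - cx (m%:R * half)); rewrite -/z mulrC => ->.
  by rewrite addrC subrK.
clearbody z; move=> root0.
have rz : root (map_poly cx (line_real n)) z.
  rewrite line_realK /root line_polyE mulf_eq0; apply/orP; right; apply/eqP.
  rewrite -[RHS]root0; apply: eq_bigr => j _; rewrite coef_map /=; congr (_ * _).
  rewrite /Gc map_comp_poly rmorphB /= map_polyX map_polyC /= horner_comp !hornerE.
  congr (_.[_]); rewrite alE mulrDr mulrA natrM -/n -[in RHS](rmorph_nat cx j).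
  have -> : cx (m%:R * half) = n%:R * cx half - cx half.
    by rewrite /n -natr1 mulrDl mul1r addrK rmorphM rmorph_nat.
  have -> : cx (half - j%:R) = cx half - cx j%:R by rewrite rmorphB.
  rewrite -[half%:C%C]/(cx half); move: (cx half) (cx j%:R) => u v. ring.
have nN : (N <= n)%N by rewrite /n (leq_trans Nm) // leqnSn.
have [rs [srs urs rrs _]] := roots_of_sign_changes (hN n nN).
(* As l > 0 there is at least one sign condition, and it is strict. *)
have nz : line_real n != 0.
  move: (hN n nN) l0; rewrite -sys; case: (ys) => //= b ys' /andP[/andP[_]].
  by case: eqVneq => // ->; rewrite !horner0 mul0r ltxx.
have sl : (size (line_real n) <= l.+1)%N.
  by rewrite -(size_map_poly cx) line_realK size_line_poly.
have [r zr] := real_rooted nz sl (etrans srs sys) urs rrs rz.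
rewrite alE zr -(rmorph_nat cx) /= /half /=.
by rewrite !(mulr0, mul0r, mulr1, subr0, addr0, add0r, oppr0) mulrA.
Qed.
End Line.

(** * Weyl groups as matrix groups *)

Section Dot.
Variables (R : realType) (l : nat).
Implicit Types (a b u v : 'rV[R]_l) (k : R).

Lemma dotE a b : dot a b = \sum_i a 0 i * b 0 i.
Proof. by rewrite /dot mxE; apply: eq_bigr => i _; rewrite mxE. Qed.

Lemma dotC a b : dot a b = dot b a.
Proof. by rewrite !dotE; apply: eq_bigr => i _; rewrite mulrC. Qed.

Lemma dotDl a b v : dot (a + b) v = dot a v + dot b v.
Proof. by rewrite /dot mulmxDl mxE. Qed.

Lemma dotZl k a v : dot (k *: a) v = k * dot a v.
Proof. by rewrite /dot -scalemxAl mxE. Qed.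

Lemma dotNl a v : dot (- a) v = - dot a v.
Proof. by rewrite -scaleN1r dotZl mulN1r. Qed.

Lemma dotBl a b v : dot (a - b) v = dot a v - dot b v.
Proof. by rewrite dotDl dotNl. Qed.

Lemma dotDr a b v : dot v (a + b) = dot v a + dot v b.
Proof. by rewrite dotC dotDl !(dotC v). Qed.

Lemma dotZr k a v : dot v (k *: a) = k * dot v a.
Proof. by rewrite dotC dotZl dotC. Qed.

Lemma dotNr a v : dot v (- a) = - dot v a.
Proof. by rewrite dotC dotNl dotC. Qed.

Lemma dotBr a b v : dot v (a - b) = dot v a - dot v b.
Proof. by rewrite dotDr dotNr. Qed.

Lemma dot_suml (I : finType) (F : I -> 'rV[R]_l) v :
  dot (\sum_i F i) v = \sum_i dot (F i) v.
Proof.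
elim/big_rec2: _ => [|i x y _ <-]; last by rewrite dotDl.
by rewrite /dot mul0mx mxE.
Qed.

Lemma dot_sumr (I : finType) (F : I -> 'rV[R]_l) v :
  dot v (\sum_i F i) = \sum_i dot v (F i).
Proof. by rewrite dotC dot_suml; apply: eq_bigr => i _; rewrite dotC. Qed.

Lemma dot_ge0 a : 0 <= dot a a.
Proof. by rewrite dotE sumr_ge0 // => i _; rewrite -expr2 sqr_ge0. Qed.

Lemma dot_gt0 a : a != 0 -> 0 < dot a a.
Proof. by rewrite lt0r dot_ge0 dot_eq0 andbT. Qed.

Lemma pairingBl u v a : pairing (u - v) a = pairing u a - pairing v a.
Proof. by rewrite /pairing dotBl mulrBr mulrBl. Qed.

Lemma pairingZl k v a : pairing (k *: v) a = k * pairing v a.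
Proof. by rewrite /pairing dotZl mulrCA !mulrA. Qed.

Lemma dot_reflection a u v : dot (reflection a u) (reflection a v) = dot u v.
Proof.
have [->|a0] := eqVneq a 0; first by rewrite /reflection !scaler0 !subr0.
rewrite -dot_eq0 in a0.
rewrite /reflection /pairing !(dotBl, dotBr, dotZl, dotZr) (dotC a v).
by field.
Qed.

Definition reflmx a : 'M[R]_l := 1%:M - (2 / dot a a) *: (a^T *m a).

Lemma mul_reflmx a v : v *m reflmx a = reflection a v.
Proof.
rewrite /reflmx mulmxBr mulmx1 -scalemxAr mulmxA [v *m _]mx11_scalar.
by rewrite mul_scalar_mx scalerA /reflection /pairing mulrAC.
Qed.

Definition indep (f : 'I_l -> 'rV[R]_l) :=
  forall x : 'I_l -> R, \sum_i x i *: f i = 0 -> forall i, x i = 0.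

Lemma indep_unitmx f : indep f -> \matrix_i f i \in unitmx.
Proof.
move=> If; rewrite -row_free_unit; apply: inj_row_free => v.
rewrite mulmx_sum_row; under eq_bigr do rewrite rowK.
by move=> /If v0; apply/rowP => i; rewrite v0 mxE.
Qed.

(** Source of the height functional and of the fundamental weights. *)
Lemma dual_exists f (x : 'I_l -> R) : indep f ->
  exists v, forall i, dot v (f i) = x i.
Proof.
move=> /indep_unitmx uf; exists (invmx (\matrix_i f i) *m \col_i x i)^T => i.
rewrite dotC /dot trmxK -[f i](rowK f) -row_mul mulmxA mulmxV // mul1mx.
by rewrite !mxE.
Qed.

End Dot.

Section Weyl.
Variables (R : realType) (l : nat) (Phi : rootSystem R l) (Delta : base Phi).

Lemma simple_indep : indep (fun i => val (Delta i)).
Proof.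
move=> x x0; have /freeP : free (map_tuple (val \o Delta) (ord_tuple l)).
  exact: base_free Delta.
apply; rewrite -[RHS]x0; apply: eq_bigr => i _.
by rewrite -tnth_nth tnth_map tnth_ord_tuple.
Qed.

(** The linear map that agrees with [w] on the simple roots. It is defined for every permutation;
    for elements of the Weyl group it induces [w] on all roots. *)
Definition wmx (w : {perm Phi}) : 'M[R]_l :=
  invmx (\matrix_i val (Delta i)) *m \matrix_i val (w (Delta i)).

Lemma mx_simple_ext (A B : 'M[R]_l) :
  (forall i, val (Delta i) *m A = val (Delta i) *m B) -> A = B.
Proof.
move=> AB; have uD := indep_unitmx simple_indep.
rewrite -[A](mulKmx uD) -[B](mulKmx uD); congr (_ *m _).
by apply/row_matrixP => i; rewrite !row_mul !rowK.
Qed.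

Lemma mul_wmx_simple w i : val (Delta i) *m wmx w = val (w (Delta i)).
Proof.
rewrite -[val (Delta i)](rowK (fun i => val (Delta i))) -row_mul /wmx mulKVmx ?rowK //.
exact: indep_unitmx simple_indep.
Qed.

Lemma wmx_refl (a : Phi) : wmx (refl_perm a) = reflmx (val a).
Proof. by apply: mx_simple_ext => i; rewrite mul_wmx_simple mul_reflmx permE. Qed.

Lemma gen_seqP (gT : finGroupType) (I : finType) (f : I -> gT) (A : {pred I}) (w : gT) :
  w \in <<[set f i | i in A]>>%g ->
  exists2 s : seq I, all (fun i => i \in A) s & w = (\prod_(i <- s) f i)%g.
Proof.
case/gen_prodgP => n [x xA ->]; elim: n x xA => [|n IH] x xA.
  by exists [::]; rewrite ?big_ord0 ?big_nil.
have [i iA xi] := imsetP (xA ord0); have [s sA sE] := IH (fun i => x (lift ord0 i)) (fun i => xA _).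
by exists (i :: s); rewrite /= ?iA // big_ord_recl big_cons xi sE.
Qed.

(** Induction on a word in reflections. The claim must cover all roots, because the first reflection
    already moves a simple root to an arbitrary one. *)
Lemma wmx_weyl (w : {perm Phi}) : w \in weyl Phi ->
  (forall a : Phi, val a *m wmx w = val (w a)) /\
  (forall u v, dot (u *m wmx w) (v *m wmx w) = dot u v).
Proof.
case/gen_seqP => s _ ->; elim: s => [|b s [IH1 IH2]].
  have e1 : wmx (\prod_(i <- [::]) refl_perm i)%g = 1%:M.
    by apply: mx_simple_ext => i; rewrite mul_wmx_simple big_nil perm1 mulmx1.
  by rewrite e1; split => [a|u v]; rewrite !mulmx1 // big_nil perm1.
have eM : wmx (\prod_(i <- b :: s) refl_perm i)%g =
    reflmx (val b) *m wmx (\prod_(i <- s) refl_perm i)%g.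
  apply: mx_simple_ext => i.
  by rewrite mul_wmx_simple big_cons permM mulmxA mul_reflmx -IH1 permE.
rewrite eM; split => [a|u v].
  by rewrite mulmxA mul_reflmx big_cons permM -IH1 permE.
by rewrite (mulmxA u) (mulmxA v) IH2 !mul_reflmx dot_reflection.
Qed.

Lemma mul_wmx w (a : Phi) : w \in weyl Phi -> val a *m wmx w = val (w a).
Proof. by case/wmx_weyl => ->. Qed.

Lemma dot_wmx w u v : w \in weyl Phi -> dot (u *m wmx w) (v *m wmx w) = dot u v.
Proof. by case/wmx_weyl. Qed.

Lemma mul_wmxM w w' (v : 'rV[R]_l) : w \in weyl Phi -> w' \in weyl Phi ->
  v *m wmx (w * w')%g = v *m wmx w *m wmx w'.
Proof.
move=> hw hw'; suff -> : wmx (w * w')%g = wmx w *m wmx w' by rewrite -[RHS]mulmxA.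
apply: mx_simple_ext => i.
by rewrite mul_wmx_simple permM [RHS]mulmxA !mul_wmx.
Qed.

Lemma mul_wmx_refl (a : Phi) v : v *m wmx (refl_perm a) = reflection (val a) v.
Proof. by rewrite wmx_refl mul_reflmx. Qed.

Lemma refl_weyl (a : Phi) : refl_perm a \in weyl Phi.
Proof. by apply: mem_gen; apply/imsetP; exists a. Qed.

Lemma wmx1 : wmx 1%g = 1%:M.
Proof. by apply: mx_simple_ext => i; rewrite mul_wmx_simple perm1 mulmx1. Qed.

Lemma wmx_inj w w' : w \in weyl Phi -> w' \in weyl Phi -> wmx w = wmx w' -> w = w'.
Proof.
by move=> hw hw' e; apply/permP => a; apply/val_inj; rewrite -!mul_wmx // e.
Qed.

Lemma pairing_weyl w (a b : Phi) : w \in weyl Phi ->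
  pairing (val (w a)) (val (w b)) = pairing (val a) (val b).
Proof. by move=> hw; rewrite /pairing -!mul_wmx // !dot_wmx. Qed.

Lemma refl_perm_conj w (a : Phi) : w \in weyl Phi ->
  (refl_perm a * w = w * refl_perm (w a))%g.
Proof.
move=> hw; apply/permP => b; rewrite !permM !permE; apply/val_inj => /=.
rewrite -mul_wmx //= /reflection mulmxBl -scalemxAl !mul_wmx // pairing_weyl //.
Qed.

Lemma refl_permK (a : Phi) : (refl_perm a * refl_perm a = 1)%g.
Proof.
by apply/permP => b; rewrite permM perm1 !permE; apply/val_inj; rewrite /= reflectionK.
Qed.

Lemma refl_perm_self (a : Phi) : refl_perm a a = opp_root a.
Proof.
by rewrite permE; apply/val_inj; rewrite /= reflection_self //; exact: root_neq0 (valP a).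
Qed.

Lemma opp_rootK (a : Phi) : opp_root (opp_root a) = a.
Proof. by apply/val_inj; rewrite /= opprK. Qed.

Lemma perm_opp_root w (a : Phi) : w \in weyl Phi -> w (opp_root a) = opp_root (w a).
Proof. by move=> hw; apply/val_inj; rewrite /= -!mul_wmx //= mulNmx. Qed.

Lemma val_root_neq0 (a : Phi) : val a != 0.
Proof. exact: root_neq0 (valP a). Qed.

Lemma ncomb_inj (f : 'I_l -> 'rV[R]_l) (k k' : 'I_l -> nat) : indep f ->
  ncomb f k = ncomb f k' -> k =1 k'.
Proof.
move=> If /eqP; rewrite -subr_eq0 /ncomb -sumrB.
under eq_bigr do rewrite -scalerBl.
by move/eqP/If => e i; move/eqP: (e i); rewrite subr_eq0 eqr_nat => /eqP.
Qed.

(** With [lam] equal to 1 on every simple root, the product with a root is its height, so positivity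
    becomes the sign of a linear form. *)
Lemma height_exists : exists lam : 'rV[R]_l, forall b : Phi,
  dot lam (val b) != 0 /\ positive Delta b = (0 < dot lam (val b)).
Proof.
have [lam hlam] := dual_exists (fun=> 1) simple_indep.
have hk k : dot lam (ncomb (val \o Delta) k) = (\sum_i k i)%:R.
  rewrite dot_sumr natr_sum; apply: eq_bigr => i _.
  by rewrite dotZr hlam mulr1.
have h0 k : ncomb (val \o Delta) k != 0 -> (0 < \sum_i k i)%N.
  apply: contraNT; rewrite -eqn0Ngt sum_nat_eq0 => /forallP k0.
  by rewrite /ncomb big1 // => i _; rewrite (eqP (k0 i)) scale0r.
exists lam => b.
have b0 := val_root_neq0 b.
case: (base_sign Delta b) => k [] bk; rewrite bk ?oppr_eq0 in b0 *.
  rewrite hk pnatr_eq0 -lt0n h0 // ltr0n h0 //; split => //.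
  by apply/asboolP; exists k.
rewrite dotNr oppr_eq0 oppr_gt0 hk pnatr_eq0 -lt0n h0 // ltNge ler0n; split=> //.
apply/asboolP => -[k']; rewrite bk => /(congr1 (dot lam)); rewrite dotNr !hk.
move=> /eqP; rewrite eq_sym -addr_eq0 -natrD pnatr_eq0 addn_eq0 => /andP[_].
by rewrite eqn0Ngt h0.
Qed.

End Weyl.
Arguments simple_indep {R l Phi} Delta.

(** * Reflection subgroups of the extended diagram *)

Section Affine.
Variables (R : realType) (l : nat) (Phi : rootSystem R l) (Delta : base Phi).
Variables (theta : Phi) (c : 'I_l -> nat).
Hypothesis htheta : is_highest_root Delta theta c.

Local Notation beta := (ext_root Delta theta).
Local Notation cc := (ext_coef c).
Implicit Types (J : {set 'I_l.+1}) (a b : Phi).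

Lemma ext_root0 : beta ord0 = opp_root theta.
Proof. by rewrite /ext_root unlift_none. Qed.

Lemma ext_rootS (i : 'I_l) : beta (lift ord0 i) = Delta i.
Proof. by rewrite /ext_root liftK. Qed.

Lemma highest_ge (b : Phi) (k : 'I_l -> nat) (i : 'I_l) :
  val b = ncomb (val \o Delta) k -> (k i <= c i)%N.
Proof.
move=> bk; have [k' tb] := htheta.2 b.
have : ncomb (val \o Delta) (fun i => k' i + k i)%N = ncomb (val \o Delta) c.
  rewrite -htheta.1 -(subrK (val b) (val theta)) tb bk /ncomb -big_split /=.
  by apply: eq_bigr => j _; rewrite natrD scalerDl.
by move/(ncomb_inj (simple_indep Delta))/(_ i) => <-; rewrite leq_addl.
Qed.

Lemma highest_coef_gt0 i : (0 < cc i)%N.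
Proof.
rewrite /ext_coef; case: unliftP => // j _.
have /(highest_ge j) : val (Delta j) = ncomb (val \o Delta) (fun p => (p == j) : nat).
  rewrite /ncomb (bigD1 j) //= eqxx scale1r big1 ?addr0 // => p /negbTE ->.
  by rewrite scale0r.
by rewrite eqxx.
Qed.

Lemma ext_combE (x : 'I_l.+1 -> R) :
  \sum_i x i *: val (beta i) =
  \sum_i (x (lift ord0 i) - x ord0 * (c i)%:R) *: val (Delta i).
Proof.
rewrite big_ord_recl ext_root0 /= htheta.1 scalerN /ncomb scaler_sumr.
under [X in _ + X]eq_bigr do rewrite ext_rootS.
rewrite addrC -sumrB; apply: eq_bigr => i _ /=.
by rewrite scalerBl scalerA.
Qed.

(** Up to a factor, the only relation among the l + 1 extended roots is the one with the marks c_i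
    as coefficients. *)
Lemma ext_dep (x : 'I_l.+1 -> R) : \sum_i x i *: val (beta i) = 0 ->
  forall i, x i = x ord0 * (cc i)%:R.
Proof.
rewrite ext_combE => /(simple_indep Delta) x0 i.
rewrite /ext_coef; case: unliftP => [p ->|->]; last by rewrite mulr1.
by move/eqP: (x0 p); rewrite subr_eq0 => /eqP.
Qed.

Lemma ext_coef_sum : \sum_i (cc i)%:R *: val (beta i) = 0.
Proof.
rewrite ext_combE big1 // => i _.
by rewrite /ext_coef liftK unlift_none mul1r subrr scale0r.
Qed.

(** All marks are positive, so a relation that misses one node is trivial: any proper set of nodes
    is independent. *)
Lemma ext_indep (x : 'I_l.+1 -> R) j : \sum_i x i *: val (beta i) = 0 ->
  x j = 0 -> forall i, x i = 0.
Proof.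
move=> /ext_dep xE xj i; rewrite xE; move/eqP: xj.
rewrite xE mulf_eq0 pnatr_eq0 eqn0Ngt highest_coef_gt0 orbF => /eqP ->.
by rewrite mul0r.
Qed.

(** * Roots in the span and in the cone of a proper set of nodes *)

Definition in_span J (b : Phi) := exists2 k : 'I_l.+1 -> int,
  forall i, i \notin J -> k i = 0 & val b = \sum_i (k i)%:~R *: val (beta i).

Definition in_cone J (b : Phi) := exists2 k : 'I_l.+1 -> nat,
  forall i, i \notin J -> k i = 0%N & val b = \sum_i (k i)%:R *: val (beta i).

Lemma in_cone_span J b : in_cone J b -> in_span J b.
Proof.
case=> k k0 bk; exists (fun i => (k i)%:Z) => [i /k0 -> //|].
by rewrite bk; apply: eq_bigr => i _.
Qed.

Lemma in_span_opp J b : in_span J b -> in_span J (opp_root b).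
Proof.
case=> k k0 bk; exists (fun i => - k i) => [i /k0 -> |]; first by rewrite oppr0.
rewrite /= bk -sumrN; apply: eq_bigr => i _.
by rewrite mulrNz scaleNr.
Qed.

Lemma in_span_refl J j b : j \in J -> in_span J b -> in_span J (refl_perm (beta j) b).
Proof.
move=> jJ [k k0 bk].
have /intrP[n hn] := root_crystallographic (valP (beta j)) (valP b).
exists (fun i => k i - n * (i == j)%:Z) => [i iJ|].
  by rewrite k0 //; case: eqVneq iJ => [->|_ _]; rewrite ?jJ // mulr0 subr0.
rewrite permE /= /reflection hn bk.
under [RHS]eq_bigr do rewrite rmorphB rmorphM /= scalerBl.
rewrite sumrB; congr (_ - _); rewrite (bigD1 j) //= eqxx mulr1 big1 ?addr0 //.
by move=> i /negbTE ->; rewrite mulr0 scale0r.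
Qed.

Lemma notin_setT J : J != finset.setT -> exists i, i \notin J.
Proof.
move=> JT; apply/existsP; rewrite -negb_forall; apply: contra JT => /forallP JT.
by apply/eqP/setP => i; rewrite inE JT.
Qed.

(* Eliminating a node outside J shows that the coefficient of beta_0 is 0 or -1
   for a positive root, and then the remaining coefficients have one sign
   because the root is dominated by theta. *)
Lemma in_span_sign J b : J != finset.setT -> in_span J b ->
  in_cone J b \/ in_cone J (opp_root b).
Proof.
move=> JT; suff pos b' : positive Delta b' -> in_span J b' ->
    in_cone J b' \/ in_cone J (opp_root b').
  case: (base_sign Delta b) => k [] bk sb.
    by apply: pos => //; apply/asboolP; exists k.
  suff : in_cone J (opp_root b) \/ in_cone J (opp_root (opp_root b)).
    by rewrite opp_rootK; case; [right|left].
  apply: pos (in_span_opp sb); apply/asboolP; exists k.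
  by rewrite /= bk opprK.
move=> {b} /asboolP[k' bk'] [k k0 bk].
have hS (i : 'I_l) : k (lift ord0 i) = (k' i)%:Z + k ord0 * (c i)%:Z.
  have e : \sum_i ((k i)%:~R : R) *: val (beta i) - ncomb (val \o Delta) k' = 0.
    by rewrite -bk bk' subrr.
  rewrite ext_combE /ncomb -sumrB /= in e.
  move: e; under eq_bigr do rewrite -scalerBl.
  move/(simple_indep Delta)/(_ i)/eqP; rewrite -addrA -opprD subr_eq0 => /eqP e.
  by apply/eqP; rewrite -(eqr_int R) e rmorphD rmorphM /= addrC.
have k'c (i : 'I_l) : (k' i <= c i)%N by exact: highest_ge bk'.
have [i0 i0J] := notin_setT JT.
have k00 : k ord0 = 0 \/ k ord0 = -1.
  case: (unliftP ord0 i0) i0J => [i ->|->] i0J; last by left; rewrite k0.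
  have := hS i; rewrite k0 //; have := k'c i.
  have := highest_coef_gt0 (lift ord0 i); rewrite /ext_coef liftK.
  by nia.
case: k00 => k00; [left|right].
  have kE i : k i = (`|k i|%N)%:Z.
    by case: (unliftP ord0 i) => [p ->|->]; rewrite ?hS k00 // mul0r addr0.
  exists (fun i => `|k i|%N) => [i /k0 -> //|].
  by rewrite bk; apply: eq_bigr => i _; rewrite {1}kE.
have kE i : k i = - (`|k i|%N)%:Z.
  case: (unliftP ord0 i) => [p ->|->]; rewrite ?hS k00 //.
  by have := k'c p; lia.
exists (fun i => `|k i|%N) => [i /k0 -> //|].
rewrite /= bk -sumrN; apply: eq_bigr => i _.
by rewrite {1}kE rmorphN scaleNr opprK.
Qed.

(** Adding the two expressions gives a nonnegative relation that vanishes outside [J], hence a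
    trivial one. *)
Lemma in_cone_excl J b : J != finset.setT -> in_cone J b -> ~ in_cone J (opp_root b).
Proof.
move=> /notin_setT[i0 i0J] [k k0 bk] [k' k0' bk'].
have e : \sum_i ((k i)%:R + (k' i)%:R : R) *: val (beta i) = 0.
  under eq_bigr do rewrite scalerDl.
  by rewrite big_split /= -bk -bk' /= subrr.
have := ext_indep e; move/(_ i0); rewrite k0 // k0' // addr0 => /(_ erefl) kk.
move: (val_root_neq0 b); rewrite bk big1 ?eqxx // => i _.
have := kk i; rewrite -natrD => /eqP; rewrite pnatr_eq0 addn_eq0 => /andP[/eqP -> _].
by rewrite scale0r.
Qed.

Lemma in_cone_beta J j : j \in J -> in_cone J (beta j).
Proof.
move=> jJ; exists (fun i => (i == j) : nat) => [i|].
  by case: eqVneq => // ->; rewrite jJ.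
rewrite (bigD1 j) //= eqxx scale1r big1 ?addr0 // => i /negbTE ->.
by rewrite scale0r.
Qed.

(** The reflection changes only the coefficient at [j]. Were the image negative, all other
    coefficients would vanish, and [b], being a nonnegative multiple of beta_j, would equal it by
    reducedness. *)
Lemma in_cone_refl J j b : J != finset.setT -> j \in J -> in_cone J b -> b != beta j ->
  in_cone J (refl_perm (beta j) b).
Proof.
move=> JT jJ cb bj.
have [//|cn] := in_span_sign JT (in_span_refl jJ (in_cone_span cb)).
case: cb => k k0 bk; case: cn => k' k0' bk'; exfalso.
have [i0 i0J] := notin_setT JT.
pose p := pairing (val b) (val (beta j)).
have e : \sum_i ((k i)%:R + (k' i)%:R - p * (i == j)%:R : R) *: val (beta i) = 0.
  under eq_bigr do rewrite scalerBl scalerDl.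
  rewrite sumrB big_split /= -bk -bk' permE /= /reflection -/p opprB (addrC (val b)) subrK.
  rewrite [X in _ - X](bigD1 j) //= eqxx mulr1 big1 ?addr0 ?subrr //.
  by move=> i /negbTE ->; rewrite mulr0 scale0r.
have i0j : (i0 == j) = false by apply: contraNF i0J => /eqP ->.
have := ext_indep e; move/(_ i0); rewrite k0 // k0' // i0j mulr0 subr0 addr0 => /(_ erefl) kk.
have bE : val b = (k j)%:R *: val (beta j).
  rewrite bk (bigD1 j) //= big1 ?addr0 // => i ij.
  have := kk i; rewrite (negbTE ij) mulr0 subr0 -natrD => /eqP.
  by rewrite pnatr_eq0 addn_eq0 => /andP[/eqP -> _]; rewrite scale0r.
have kR : (k j)%:R *: val (beta j) \in Defs.roots Phi by rewrite -bE; exact: valP.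
have [k1|k1] := root_reduced (valP (beta j)) kR.
  by move: bj; rewrite -val_eqE bE k1 scale1r eqxx.
by have : (0 : R) <= (k j)%:R by []; rewrite k1 oppr_ge0 ler10.
Qed.

(** * Words in the reflections and the exchange condition *)

Definition word (s : seq 'I_l.+1) : {perm Phi} := (\prod_(i <- s) refl_perm (beta i))%g.

Definition subW J : {group {perm Phi}} :=
  [group of <<[set refl_perm (beta j) | j in J]>>%g].

Lemma subW_weyl J : subW J \subset weyl Phi.
Proof.
by rewrite gen_subG; apply/fintype.subsetP => w /imsetP[j _ ->]; exact: refl_weyl.
Qed.

Lemma subW_word J w : w \in subW J -> exists2 s, all (fun i => i \in J) s & w = word s.
Proof. exact: gen_seqP. Qed.

Lemma refl_subW J j : j \in J -> refl_perm (beta j) \in subW J.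
Proof. by move=> jJ; apply: mem_gen; apply/imsetP; exists j. Qed.

Lemma word_cat s1 s2 : word (s1 ++ s2) = (word s1 * word s2)%g.
Proof. by rewrite /word big_cat. Qed.

Lemma word_cons i s : word (i :: s) = (refl_perm (beta i) * word s)%g.
Proof. by rewrite /word big_cons. Qed.

Lemma word_weyl s : word s \in weyl Phi.
Proof. by rewrite /word; apply: group_prod => i _; exact: refl_weyl. Qed.

(** Follow [b] along the word, read from the left: the letter at which it leaves the cone must be
    the reflection in the root reached at that moment. *)
Lemma exchange_root J s b : J != finset.setT -> all (fun i => i \in J) s ->
  in_cone J b -> in_cone J (opp_root (word s b)) ->
  exists s1 i s2, s = s1 ++ i :: s2 /\ word s1 b = beta i.
Proof.
move=> JT; elim: s b => [|i s IH] b /= sJ cb.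
  by rewrite /word big_nil perm1 => /(in_cone_excl JT cb).
case/andP: sJ => iJ sJ; rewrite word_cons permM => cn.
have [bi|bi] := eqVneq b (beta i).
  by exists [::], i, s; rewrite /word big_nil perm1.
have [s1 [j [s2 [sE e]]]] := IH _ sJ (in_cone_refl JT iJ cb bi) cn.
by exists (i :: s1), j, s2; rewrite sE word_cons permM.
Qed.

(** As [word s1] carries beta_j to beta_i, the reflection in beta_j moves past [word s1] as the one
    in beta_i and cancels the letter [i]. *)
Lemma word_shorten J s j : J != finset.setT -> all (fun i => i \in J) s -> j \in J ->
  in_cone J (opp_root (word s (beta j))) ->
  exists s', [/\ all (fun i => i \in J) s', (size s' < size s)%N &
    word s' = (refl_perm (beta j) * word s)%g].
Proof.
move=> JT sJ jJ cn.
have [s1 [i [s2 [sE e]]]] := exchange_root JT sJ (in_cone_beta jJ) cn.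
exists (s1 ++ s2); move: sJ; rewrite sE !all_cat /= => /and3P[-> _ ->].
split; rewrite // ?size_cat ?size_cat /= ?addnS ?ltnSn //.
rewrite !word_cat word_cons mulgA (refl_perm_conj Delta _ (word_weyl s1)) e.
by rewrite -!mulgA [(refl_perm _ * (_ * _))%g]mulgA refl_permK mul1g.
Qed.

(** The image of beta_j for the first letter [j] has a sign. If it is negative, [j] is the descent;
    if positive, the tail sends beta_j to a negative root, and the exchange condition yields a
    shorter word for the same element. *)
Lemma word_descent J s : J != finset.setT -> all (fun i => i \in J) s ->
  word s = 1%g \/ exists2 j, j \in J & in_cone J (opp_root (word s (beta j))).
Proof.
move=> JT; have [n] := ubnP (size s); elim: n s => // n IH [|j s] /=.
  by left; rewrite /word big_nil.
rewrite ltnS => sn /andP[jJ sJ].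
have jsJ : all (fun i => i \in J) (j :: s) by rewrite /= jJ.
have sp : in_span J (word (j :: s) (beta j)).
  elim/last_ind: {sn sJ} (j :: s) jsJ => [_|s' i IHs].
    by rewrite /word big_nil perm1; apply/in_cone_span/in_cone_beta.
  rewrite all_rcons => /andP[iJ /IHs].
  by rewrite -cats1 word_cat permM /word big_seq1; exact: in_span_refl.
have [cp|cn] := in_span_sign JT sp; last by right; exists j.
have [|s' [s'J ss' s'E]] := @word_shorten J s j JT sJ jJ.
  by move: cp; rewrite word_cons permM refl_perm_self (perm_opp_root Delta) // word_weyl.
rewrite word_cons -s'E; apply: IH s'J; exact: leq_ltn_trans (ltnW ss') sn.
Qed.

Lemma dual_ext J (x : 'I_l.+1 -> R) : J != finset.setT ->
  exists v, forall i, i \in J -> dot v (val (beta i)) = x i.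
Proof.
move=> /notin_setT[i0 i0J].
have If : indep (fun k => val (beta (lift i0 k))).
  move=> y y0 k; pose x' i := if unlift i0 i is Some k then y k else 0.
  have e : \sum_i x' i *: val (beta i) = 0.
    rewrite (bigD1_ord i0) //= /x' unlift_none scale0r add0r -[RHS]y0.
    by apply: eq_bigr => i _; rewrite liftK.
  have := ext_indep e; move/(_ i0); rewrite /x' unlift_none => /(_ erefl).
  by move/(_ (lift i0 k)); rewrite liftK.
have [v hv] := dual_exists (fun k => x (lift i0 k)) If.
exists v => i iJ; case: (unliftP i0 i) => [k ->|ii0]; first exact: hv.
by rewrite -ii0 iJ in i0J.
Qed.

(** * Coset representatives that are positive on a set of nodes *)

Definition Jpositive J (w : {perm Phi}) := [forall j in J, positive Delta (w (beta j))].

(** A descent of [z] at [j] would make [(z * u)] send beta_j to a nonpositive combination of the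
    positive roots u(beta_i), of height at most 0. *)
Lemma Jpositive_unique J u z : J != finset.setT -> u \in weyl Phi -> z \in subW J ->
  Jpositive J u -> Jpositive J (z * u)%g -> z = 1%g.
Proof.
move=> JT uW /subW_word[s sJ ->] /forall_inP pu /forall_inP pzu.
case: (word_descent JT sJ) => // -[j jJ [k k0 kE]].
have [lam hlam] := height_exists Delta.
have := pzu j jJ; rewrite permM (hlam _).2 ltNge => /negP[].
have -> : val (u (word s (beta j))) = - \sum_i (k i)%:R *: val (u (beta i)).
  rewrite -(mul_wmx Delta) // -[val (word s _)]opprK [- val _]kE mulNmx mulmx_suml.
  by congr (- _); apply: eq_bigr => i _; rewrite -scalemxAl (mul_wmx Delta).
rewrite dotNr oppr_le0 dot_sumr sumr_ge0 // => i _; rewrite dotZr.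
case: (boolP (i \in J)) => [/pu|/k0 ->]; last by rewrite mul0r.
by rewrite (hlam _).2 => /ltW ?; rewrite mulr_ge0.
Qed.

(** Take [v] with product 1 with every beta_j in [J], and [z] in W_J maximizing the height of the
    image of [v] under [z * w]. Comparing with the reflection in beta_j times [z] shows that z w
    sends beta_j to a positive root. *)
Lemma Jpositive_exists J w : J != finset.setT -> w \in weyl Phi ->
  exists2 z, z \in subW J & Jpositive J (z * w)%g.
Proof.
move=> JT wW; have [v hv] := dual_ext (fun=> 1) JT.
have [lam hlam] := height_exists Delta.
pose Psi z := dot lam (v *m wmx Delta (z * w)%g).
have [z zJ zmax] := @arg_maxP _ _ _ 1%g (fun z => z \in subW J) Psi (group1 _).
exists z => //; apply/forall_inP => j jJ.
have zW : z \in weyl Phi by exact: (fintype.subsetP (subW_weyl J)).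
have := zmax _ (groupM (refl_subW jJ) zJ); rewrite /Psi -mulgA.
rewrite /= (mul_wmxM Delta (w := refl_perm (beta j))) ?refl_weyl ?groupM // mul_wmx_refl.
rewrite /reflection mulmxBl -scalemxAl (mul_wmx Delta) ?groupM // dotBr dotZr.
rewrite gerBl /pairing hv // mulr1 pmulr_rge0; last first.
  by rewrite divr_gt0 // dot_gt0 // val_root_neq0.
by rewrite le0r (negbTE (hlam _).1) /= (hlam _).2.
Qed.

(** Multiplication (z, u) -> z u is a bijection onto W: each coset W_J w contains exactly one
    [J]-positive element. *)
Lemma card_Jpositive J : J != finset.setT ->
  (#|subW J| * #|[set w in weyl Phi | Jpositive J w]|)%N = #|weyl Phi|.
Proof.
move=> JT; set N := [set w in _ | _].
have sub := fintype.subsetP (subW_weyl J).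
rewrite -cardsX -(card_in_imset (f := fun p : {perm Phi} * {perm Phi} => (p.1 * p.2)%g)).
  apply: eq_card => w; apply/imsetP/idP => [[[z u]]|wW].
    rewrite inE /= inE => /andP[/sub zW /andP[uW _]] ->.
    exact: groupM.
  have [z zJ pz] := Jpositive_exists JT wW.
  exists (z^-1, z * w)%g; rewrite /= ?mulKg // inE /= groupV zJ inE pz andbT.
  by rewrite groupM // sub.
move=> [z u] [z' u'] /=; rewrite !inE /= => /andP[zJ /andP[uW pu]] /andP[zJ' /andP[uW' pu']] e.
have u'E : u' = (z'^-1 * z * u)%g by rewrite -mulgA e mulKg.
have := @Jpositive_unique J u (z'^-1 * z)%g JT uW; rewrite groupM ?groupV // -u'E.
move=> /(_ isT pu pu') zz; have -> : z = z' by rewrite -[z](mulKVg z') zz mulg1.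
by rewrite u'E zz mul1g.
Qed.

(** * The orbit of a fundamental weight and its stabilizer *)

Section Step.
Variables (J : {set 'I_l.+1}) (j : 'I_l.+1) (om : 'rV[R]_l).
Hypotheses (JT : J != finset.setT) (jJ : j \in J).
Hypothesis om_fund : forall i, i \in J -> pairing om (val (beta i)) = (i == j)%:R.

Let om_ge0 i : i \in J -> 0 <= dot om (val (beta i)) ?= iff (i != j).
Proof.
move=> iJ; have b0 := dot_gt0 (val_root_neq0 (beta i)).
have -> : dot om (val (beta i)) = pairing om (val (beta i)) * dot (val (beta i)) (val (beta i)) / 2.
  by rewrite /pairing divfK ?gt_eqF // mulrAC divff ?mul1r ?pnatr_eq0.
rewrite om_fund //; case: eqVneq => _ /=; last by rewrite mulr0n !mul0r; exact: leif_refl.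
by rewrite mul1r; split; [rewrite divr_ge0 // ltW|rewrite lt_eqF // divr_gt0].
Qed.

(** Induction on word length. A descent [i] of [z] differs from [j], for [om] has positive product
    with beta_j, hence, being fixed, with z(beta_j). So the reflection in beta_i fixes [om] and can
    be removed. *)
Lemma fund_stab z : z \in subW J -> om *m wmx Delta z = om -> z \in subW (J :\ j).
Proof.
case/subW_word => s; have [n] := ubnP (size s); elim: n s z => // n IH s z.
rewrite ltnS => sn sJ -> fixo.
case: (word_descent JT sJ) => [->|[i iJ ci]]; first exact: group1.
have ij : i != j.
  apply/negP => /eqP ij; rewrite ij in ci; case: ci => k k0 kE.
  have [p1 p2] := om_ge0 jJ; rewrite eqxx /= in p2.
  have : 0 < dot om (val (word s (beta j))).
    rewrite -{1}fixo -(mul_wmx Delta) ?word_weyl // dot_wmx ?word_weyl //.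
    by rewrite lt_neqAle p1 p2.
  rewrite -[val (word s _)]opprK [- val _]kE dotNr oppr_gt0 ltNge dot_sumr.
  rewrite sumr_ge0 // => p _; rewrite dotZr; case: (boolP (p \in J)) => [pJ|/k0 ->].
    by rewrite mulr_ge0 // (om_ge0 pJ).1.
  by rewrite mul0r.
have [s' [s'J ss' s'E]] := word_shorten JT sJ iJ ci.
have /(IH s' (word s')) : (size s' < n)%N by exact: leq_trans ss' sn.
move=> /(_ s'J erefl).
have iJ' : i \in J :\ j by rewrite !inE ij.
rewrite s'E (mul_wmxM Delta) ?refl_weyl ?word_weyl // mul_wmx_refl.
rewrite /reflection om_fund // (negbTE ij) scale0r subr0 => /(_ fixo).
by rewrite groupMl // refl_subW.
Qed.

Lemma fund_fixed z : z \in subW (J :\ j) -> om *m wmx Delta z = om.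
Proof.
case/subW_word => s sJ ->; elim: s sJ => [_|i s IH] /=.
  by rewrite /word big_nil wmx1 mulmx1.
case/andP; rewrite !inE => /andP[ij iJ] /IH e.
rewrite word_cons (mul_wmxM Delta) ?refl_weyl ?word_weyl // mul_wmx_refl.
by rewrite /reflection om_fund // (negbTE ij) scale0r subr0.
Qed.

(** Weight coordinates relative to [J], padded with zeros so that all vectors have length l + 1. *)
Definition coords (v : 'rV[R]_l) : seq R :=
  [seq (if i \in J then pairing v (val (beta i)) else 0) | i : 'I_l.+1].

Let orbit_span z : z \in subW J -> exists2 y : 'I_l.+1 -> R,
  forall i, i \notin J -> y i = 0 & om *m wmx Delta z = om + \sum_i y i *: val (beta i).
Proof.
case/subW_word => s sJ ->; elim/last_ind: s sJ => [_|s i IH].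
  exists (fun=> 0) => //; rewrite /word big_nil wmx1 mulmx1 big1 ?addr0 // => i _.
  by rewrite scale0r.
rewrite all_rcons => /andP[iJ /IH[y y0 yE]].
rewrite -cats1 word_cat (mul_wmxM Delta) ?word_weyl // yE.
rewrite /word big_seq1 mul_wmx_refl /reflection.
set p := pairing _ _; exists (fun k => y k - p * (k == i)%:R) => [k kJ|].
  by rewrite y0 //; case: eqVneq kJ => [->|_ _]; rewrite ?iJ // mulr0 subr0.
rewrite -addrA; congr (_ + _); under [RHS]eq_bigr do rewrite scalerBl.
rewrite sumrB; congr (_ - _); rewrite (bigD1 i) //= eqxx mulr1 big1 ?addr0 //.
by move=> k /negbTE ->; rewrite mulr0 scale0r.
Qed.

(** The difference of two orbit points lies in the span of the beta_i, i in [J], and is orthogonal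
    to all of them. *)
Lemma coords_inj z z' : z \in subW J -> z' \in subW J ->
  coords (om *m wmx Delta z) = coords (om *m wmx Delta z') ->
  om *m wmx Delta z = om *m wmx Delta z'.
Proof.
move=> /orbit_span[y y0 yE] /orbit_span[y' y0' yE'] /eq_in_map e.
have dE : om *m wmx Delta z - om *m wmx Delta z' = \sum_i (y i - y' i) *: val (beta i).
  rewrite yE yE' opprD addrACA subrr add0r -sumrB.
  by apply: eq_bigr => i _; rewrite scalerBl.
apply/eqP; rewrite -subr_eq0 -dot_eq0 {2}dE dot_sumr big1 // => i _.
case: (boolP (i \in J)) => [iJ|iJ]; last by rewrite y0 // y0' // subrr scale0r dotC /dot mul0mx mxE.
have := e i; rewrite mem_enum iJ => /(_ isT)/eqP.
rewrite -subr_eq0 -pairingBl /pairing !mulf_eq0 invr_eq0 pnatr_eq0 /=.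
rewrite dot_eq0 (negbTE (val_root_neq0 _)) orbF dotZr => /eqP ->.
by rewrite mulr0.
Qed.

(** Orbit-stabilizer: [L] lists the orbit of [om] in coordinates, and the orbit points correspond to
    the cosets of the stabilizer W_{J - j}. *)
Lemma card_subW_step (L : seq (seq R)) : uniq L ->
  (forall z, z \in subW J -> coords (om *m wmx Delta z) \in L) ->
  (forall t, t \in L -> exists2 z, z \in subW J & t = coords (om *m wmx Delta z)) ->
  #|subW J| = (#|subW (J :\ j)| * size L)%N.
Proof.
move=> uL L1 L2; set H := subW (J :\ j).
have HJ : H \subset subW J.
  rewrite gen_subG; apply/fintype.subsetP => w /imsetP[ i].
  rewrite !inE => /andP[_ iJ] ->.
  exact: refl_subW.
have JW := fintype.subsetP (subW_weyl J).
rewrite -(Lagrange HJ); congr (_ * _)%N.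
pose f z := coords (om *m wmx Delta z).
have fH y z : y \in H -> z \in subW J -> f (y * z)%g = f z.
  move=> yH zJ; rewrite /f (mul_wmxM Delta) ?JW // ?(fintype.subsetP HJ) //.
  by rewrite fund_fixed.
have fr z : z \in subW J -> f (repr (H :* z)%g) = f z.
  by move=> zJ; case: repr_rcosetP => y yH; exact: fH.
rewrite /indexg cardE -(size_map (fun C => f (repr C))).
apply/perm_size/uniq_perm => //.
  rewrite map_inj_in_uniq ?enum_uniq // => C C'; rewrite !mem_enum.
  move=> /rcosetsP[z zJ ->] /rcosetsP[z' zJ' ->]; rewrite !fr // => /(coords_inj zJ zJ') e.
  apply/rcoset_eqP; rewrite mem_rcoset; apply: fund_stab; first by rewrite groupM ?groupV.
  rewrite (mul_wmxM Delta) ?groupV ?JW // e -(mul_wmxM Delta) ?groupV ?JW //.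
  by rewrite mulgV wmx1 mulmx1.
move=> t; apply/mapP/idP => [[C]|/L2[z zJ ->]].
  rewrite mem_enum => /rcosetsP[z zJ ->] ->; rewrite fr //; exact: L1.
exists (H :* z)%g; last by rewrite fr.
by rewrite mem_enum; apply/rcosetsP; exists z.
Qed.

End Step.

End Affine.

(** * Integer computations *)

(* Too little fuel yields an incomplete list, which closed_under detects. *)
Fixpoint bfs (T : eqType) (steps : T -> seq T) (fuel : nat) (seen front : seq T) :
    seq T :=
  if fuel is n.+1 then
    let new := undup [seq x <- flatten (map steps front) | x \notin seen] in
    if new is [::] then seen else bfs steps n (new ++ seen) new
  else seen.

Definition closed_under (T : eqType) (steps : T -> seq T) (L : seq T) :=
  all (fun x => all (mem L) (steps x)) L.

Lemma bfs_ind (T : eqType) (steps : T -> seq T) (P : T -> Prop) fuel seen front :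
  (forall x y, P x -> y \in steps x -> P y) ->
  (forall x, x \in seen -> P x) -> (forall x, x \in front -> P x) ->
  forall x, x \in bfs steps fuel seen front -> P x.
Proof.
move=> Pst; elim: fuel seen front => //= n IH seen front Ps Pf.
set new := undup _.
have Pn x : x \in new -> P x.
  rewrite mem_undup mem_filter => /andP[_ /flattenP[_ /mapP[y yf ->]]].
  by apply: Pst; exact: Pf.
case E: new => [|y new'] //; apply: IH => x; rewrite -E ?mem_cat; last exact: Pn.
by case/orP => [/Pn|/Ps].
Qed.

Lemma bfs_sub (T : eqType) (steps : T -> seq T) fuel seen front :
  {subset seen <= bfs steps fuel seen front}.
Proof.
elim: fuel seen front => [|n IH] seen front x xs //=.
case E: (undup _) => [|y new'] //; apply: IH.
by rewrite mem_cat xs orbT.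
Qed.

Section Zr.
Variable R : realType.

(** Computations run on binary integers, which reduce well; [zr] carries their results to the real
    field. *)
Definition zr (z : Z) : R := (int_of_Z z)%:~R.

Lemma zr0 : zr Z0 = 0. Proof. by []. Qed.
Lemma zr1 : zr (Zpos xH) = 1. Proof. by []. Qed.
Lemma zrD x y : zr (Z.add x y) = zr x + zr y.
Proof. by rewrite /zr -rmorphD -(rmorphD int_of_Z). Qed.
Lemma zrN x : zr (Z.opp x) = - zr x.
Proof. by rewrite /zr -rmorphN -(rmorphN int_of_Z). Qed.
Lemma zrB x y : zr (Z.sub x y) = zr x - zr y.
Proof. by rewrite -zrN -zrD; congr zr; lia. Qed.
Lemma zrM x y : zr (Z.mul x y) = zr x * zr y.
Proof. by rewrite /zr -rmorphM -(rmorphM int_of_Z). Qed.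
Lemma zr_nat n : zr (Z.of_nat n) = n%:R.
Proof.
elim: n => // n IH; rewrite -addn1 natrD -IH -zr1 -zrD; congr zr; lia.
Qed.
Lemma zr_inj : injective zr.
Proof.
by move=> x y /eqP; rewrite eqr_int => /eqP /(can_inj int_of_ZK).
Qed.
Lemma zr_lt0 x : (zr x < 0) = Z.ltb x Z0.
Proof. by rewrite /zr ltrz0; case: x => //= p; rewrite ?ltz_nat //; lia. Qed.
Lemma zr_lt x y : (zr x < zr y) = Z.ltb x y.
Proof. by rewrite -subr_lt0 -zrB zr_lt0; lia. Qed.
Lemma zr_eq0 x : (zr x == 0) = Z.eqb x Z0.
Proof. by rewrite -zr0 (inj_eq zr_inj). Qed.
Lemma zr_of_int x : zr (Z_of_int x) = x%:~R.
Proof. by rewrite /zr Z_of_intK. Qed.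
End Zr.

Definition sumz (s : seq nat) (F : nat -> Z) : Z := foldr (fun i acc => Z.add (F i) acc) Z0 s.

Lemma zr_sumz (R : realType) n (F : nat -> Z) :
  zr R (sumz (iota 0 n) F) = \sum_(i < n) zr R (F i).
Proof.
have -> : zr R (sumz (iota 0 n) F) = \sum_(i <- iota 0 n) zr R (F i).
  by elim: (iota 0 n) => [|i s IH]; rewrite ?big_nil ?big_cons //= zrD IH.
by rewrite -{1}(subn0 n) -/(index_iota 0 n) big_mkord.
Qed.

Fixpoint vsub (a : Z) (v r : seq Z) : seq Z :=
  match v, r with
  | x :: v', y :: r' => Z.sub x (Z.mul a y) :: vsub a v' r'
  | _, _ => [::]
  end.

Lemma size_vsub a v r : size v = size r -> size (vsub a v r) = size v.
Proof. by elim: v r => [|x v IH] [|y r] //= [/IH ->]. Qed.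

Lemma nth_vsub a v r k : size v = size r ->
  nth Z0 (vsub a v r) k = Z.sub (nth Z0 v k) (Z.mul a (nth Z0 r k)).
Proof.
elim: v r k => [|x v IH] [|y r] //= k; first by rewrite !nth_nil; lia.
by move=> [e]; case: k => //= k; rewrite IH.
Qed.

Definition unitv (n j : nat) : seq Z := mkseq (fun k => if k == j then Zpos xH else Z0) n.

Definition mask_row (E : seq (seq Z)) (n : nat) (J : seq nat) (i : nat) : seq Z :=
  mkseq (fun k => if k \in J then nth Z0 (nth [::] E i) k else Z0) n.

(** In weight coordinates the reflection in beta_i subtracts v_i times row i of the Cartan
    matrix. *)
Definition wsteps (rows : seq (nat * seq Z)) (v : seq Z) : seq (seq Z) :=
  [seq vsub (nth Z0 v r.1) v r.2 | r <- rows].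

(** The unit vector at [j] is the fundamental weight. The answer is given only if the list found is
    duplicate-free and stable under the reflections. *)
Definition orbit_size (fuel : nat) (E : seq (seq Z)) (n : nat) (J : seq nat) (j : nat) : option Z :=
  let rows := [seq (i, mask_row E n J i) | i <- J] in
  let u := [:: unitv n j] in
  let L := bfs (wsteps rows) fuel u u in
  if uniq L && closed_under (wsteps rows) L then Some (Z.of_nat (size L)) else None.

Fixpoint padd (p q : seq Z) : seq Z :=
  match p, q with
  | [::], _ => q
  | _, [::] => p
  | x :: p', y :: q' => Z.add x y :: padd p' q'
  end.

Definition pmulXn1 (c : nat) (q : seq Z) : seq Z := padd (ncons c Z0 q) (map Z.opp q).

(* With o = |W_J|, this computes M / |W| times the sum, over the w that are
   positive on J, of prod_{k in ks} (if w beta_k > 0 then x^{c_k} else 1); no w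
   is positive on all n nodes, so the full J contributes nothing. *)
Fixpoint eul (fuel : nat) (E : seq (seq Z)) (n : nat) (cs : seq nat) (M : Z)
    (ks J : seq nat) (o : Z) : option (seq Z) :=
  match ks with
  | [::] => if Z.eqb (Z.mul o (Z.div M o)) M then Some [:: Z.div M o] else None
  | k :: ks' =>
    match eul fuel E n cs M ks' J o with
    | None => None
    | Some p =>
      if (size J).+1 == n then Some p else
      match orbit_size fuel E n (k :: J) k with
      | None => None
      | Some N =>
        match eul fuel E n cs M ks' (k :: J) (Z.mul o N) with
        | None => None
        | Some q => Some (padd p (pmulXn1 (nth 0%N cs k) q))
        end
      end
    end
  end.

Section PolyZ.
Variable R : realType.
Definition polZ (p : seq Z) : {poly R} := Poly (map (zr R) p).

Lemma polZ_cons x p : polZ (x :: p) = polZ p * 'X + (zr R x)%:P.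
Proof. by rewrite /polZ /= cons_poly_def. Qed.

Lemma polZ_padd p q : polZ (padd p q) = polZ p + polZ q.
Proof.
have pol0 : polZ [::] = 0 by [].
elim: p q => [|x p IH] [|y q] /=; rewrite ?pol0 ?add0r ?addr0 //.
by rewrite !polZ_cons IH zrD polyCD mulrDl addrACA.
Qed.

Lemma polZ_pmulXn1 k q : polZ (pmulXn1 k q) = ('X^k - 1) * polZ q.
Proof.
rewrite /pmulXn1 polZ_padd mulrBl mul1r; congr (_ + _).
  elim: k => [|k IH]; first by rewrite mul1r.
  by rewrite [ncons _ _ _]/= polZ_cons IH zr0 addr0 exprSr mulrAC.
elim: q => [|x q IH]; first by rewrite /polZ /= oppr0.
by rewrite [map _ _]/= !polZ_cons IH zrN polyCN opprD mulNr.
Qed.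
End PolyZ.

(** In simple-root coordinates the i-th reflection changes only coordinate i, by the pairing with
    the i-th coroot. *)
Definition rstep (C : seq (seq Z)) (n i : nat) (v : seq Z) : seq Z :=
  mkseq (fun k => if k == i then
    Z.sub (nth Z0 v k) (sumz (iota 0 n) (fun p => Z.mul (nth Z0 v p) (nth Z0 (nth [::] C p) i)))
    else nth Z0 v k) n.

Definition rsteps C n v := [seq rstep C n i v | i <- iota 0 n].

Definition root_list fuel C n := let u := [seq unitv n i | i <- iota 0 n] in
  bfs (rsteps C n) fuel u u.

Definition cox C n (v : seq Z) := foldl (fun v i => rstep C n i v) v (iota 0 n).

(** Gaussian integers as pairs of real and imaginary part. *)
Definition gmul (x y : Z * Z) : Z * Z :=
  (Z.sub (Z.mul x.1 y.1) (Z.mul x.2 y.2), Z.add (Z.mul x.1 y.2) (Z.mul x.2 y.1)).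

Definition gpow (x : Z * Z) (n : nat) : Z * Z := iter n (gmul x) (Zpos xH, Z0).

(* Re of sum_j a_j (2 p - i (h - 2 j))^l *)
Definition line_sum (a : seq Z) (h l : nat) (p : Z) : Z :=
  sumz (iota 0 h.+1) (fun j => Z.mul (nth Z0 a j)
    (gpow (Z.mul (Zpos 2) p, Z.sub (Z.of_nat (j.*2)) (Z.of_nat h)) l).1).

(** * Numerical data of the five types, verified by computation below *)

Section Types.
Variable X : exceptional.

Definition cartZ : seq (seq Z) := map (map Z_of_int) (cartan_rows X).

Definition marks : seq nat :=
  match X with
  | E6 => [:: 1; 2; 2; 3; 2; 1]
  | E7 => [:: 2; 2; 3; 4; 3; 2; 1]
  | E8 => [:: 2; 3; 4; 6; 5; 4; 3; 2]
  | F4 => [:: 2; 3; 4; 2]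
  | G2 => [:: 3; 2]
  end%N.

Definition cox_num : nat := match X with E6 => 12 | E7 => 18 | E8 => 30 | F4 => 12 | G2 => 6 end%N.

(* Half squared lengths of the simple roots, the short ones having 1. *)
Definition half_len : seq Z :=
  match X with
  | F4 => map Z.of_nat [:: 2; 2; 1; 1]
  | G2 => map Z.of_nat [:: 1; 3]
  | _ => nseq (rank_of X) (Zpos 1)
  end%N.

(* (child, parent) pairs of the Dynkin tree rooted at the first simple root *)
Definition dynkin_edges : seq (nat * nat) :=
  match X with
  | E6 => [:: (2, 0); (3, 2); (1, 3); (4, 3); (5, 4)]
  | E7 => [:: (2, 0); (3, 2); (1, 3); (4, 3); (5, 4); (6, 5)]
  | E8 => [:: (2, 0); (3, 2); (1, 3); (4, 3); (5, 4); (6, 5); (7, 6)]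
  | F4 => [:: (1, 0); (2, 1); (3, 2)]
  | G2 => [:: (1, 0)]
  end%N.

(** Serves as the common multiple M of the orders |W_J|; [eul] checks each divisibility. *)
Definition weyl_order : Z :=
  match X with
  | E6 => Zpos 51840 | E7 => Zpos 2903040 | E8 => Zpos 696729600
  | F4 => Zpos 1152 | G2 => Zpos 12
  end.

(** The l + 1 points between which T changes sign l times. They are symmetric because T(-y) = (-1)^l
    T(y); for odd l this makes 0 a zero of T, so 0 is avoided. *)
Definition sample_points : seq Z :=
  let sym s := map (Z.opp \o Z.of_nat) (rev s) ++ map Z.of_nat s in
  let sym0 s := map (Z.opp \o Z.of_nat) (rev s) ++ Z0 :: map Z.of_nat s in
  match X with
  | E6 => sym0 [:: 2; 4; 6]
  | E7 => sym [:: 1; 3; 6; 9]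
  | E8 => sym0 [:: 3; 6; 10; 15]
  | F4 => sym0 [:: 2; 5]
  | G2 => sym0 [:: 2]
  end%N.

Let l := rank_of X.
Let cart i j := nth Z0 (nth [::] cartZ i) j.

Definition theta_pairing : seq Z :=
  mkseq (fun k => sumz (iota 0 l) (fun i => Z.mul (Z.of_nat (nth 0%N marks i)) (cart i k))) l.

(** Half of (theta, theta), from (theta, alpha_k) = (theta, alpha_k^vee) (alpha_k, alpha_k) / 2, in
    the unit of [half_len]. *)
Definition theta_half_len : Z :=
  Z.div (sumz (iota 0 l) (fun k => Z.mul (Z.of_nat (nth 0%N marks k))
    (Z.mul (nth Z0 half_len k) (nth Z0 theta_pairing k)))) (Zpos 2).

(** Row and column 0 belong to -theta; the column needs a quotient of lengths, whose exactness
    [ext_cartan_ok] tests. *)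
Definition ext_cartan : seq (seq Z) :=
  (Zpos 2 :: map Z.opp theta_pairing) ::
  mkseq (fun k => Z.opp (Z.div (Z.mul (nth Z0 half_len k) (nth Z0 theta_pairing k)) theta_half_len)
    :: nth [::] cartZ k) l.

Definition eulZ : option (seq Z) :=
  eul 100 ext_cartan l.+1 (1%N :: marks) weyl_order (rcons (iota 1 l) 0%N) [::] (Zpos 1).
End Types.

(** * Ascent counts from orbit sizes *)

Section Spec.
Variables (R : realType) (l : nat) (Phi : rootSystem R l) (Delta : base Phi).
Variables (theta : Phi) (c : 'I_l -> nat).
Hypothesis htheta : is_highest_root Delta theta c.
Variables (fuel : nat) (E : seq (seq Z)).
Local Notation beta := (ext_root Delta theta).
Local Notation zr := (zr R).
Hypothesis hE : forall i k : 'I_l.+1,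
  pairing (val (beta i)) (val (beta k)) = zr (nth Z0 (nth [::] E i) k).

Definition setJ (J : seq nat) : {set 'I_l.+1} := [set i : 'I_l.+1 | (i : nat) \in J].

Lemma setJ_cons k J : (k < l.+1)%N -> k \notin J -> setJ (k :: J) :\ inord k = setJ J.
Proof.
move=> kl kJ; apply/setP => i; rewrite !inE -val_eqE /= inordK //.
by case: eqVneq => //= ->; rewrite (negbTE kJ).
Qed.

Lemma setJ_proper J : uniq J -> (size J < l.+1)%N -> setJ J != finset.setT.
Proof.
move=> uJ sJ; apply/negP => /eqP JT.
have : {subset iota 0 l.+1 <= J}.
  move=> k; rewrite mem_iota /= add0n => kl.
  have := finset.in_setT (Ordinal kl); rewrite -JT inE //.
move/(uniq_leq_size (iota_uniq _ _)); rewrite size_iota => /leq_ltn_trans/(_ sJ).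
by rewrite ltnn.
Qed.

Lemma setJ_full J : uniq J -> all (fun k => k < l.+1)%N J -> size J = l.+1 ->
  setJ J = finset.setT.
Proof.
move=> uJ /allP Jl sJ; apply/setP => i; rewrite !inE.
have sub : {subset J <= iota 0 l.+1} by move=> k /Jl; rewrite mem_iota.
have sz : (size (iota 0 l.+1) <= size J)%N by rewrite size_iota sJ.
have [_ ->] := uniq_min_size uJ sub sz.
by rewrite mem_iota ltn_ord.
Qed.

Lemma coordsP J (v : 'rV[R]_l) t : size t = l.+1 ->
  coords Delta theta J v = map zr t <->
  forall k : 'I_l.+1, (if k \in J then pairing v (val (beta k)) else 0) = zr (nth Z0 t k).
Proof.
move=> st; have sz : size (coords Delta theta J v) = l.+1.
  by rewrite size_map size_enum_ord.
have nc (k : 'I_l.+1) : nth 0 (coords Delta theta J v) k =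
    if k \in J then pairing v (val (beta k)) else 0.
  by rewrite (nth_map ord0) ?size_enum_ord // nth_ord_enum.
split=> [e k|e]; first by rewrite -nc e (nth_map Z0) ?st.
apply: (@eq_from_nth _ 0); first by rewrite sz size_map st.
move=> i; rewrite sz => il; rewrite (nth_map Z0) ?st //.
by rewrite -[ i ]/(nat_of_ord (Ordinal il)) nc e.
Qed.

Lemma size_mask_row n J i : size (mask_row E n J i) = n.
Proof. exact: size_mkseq. Qed.

Lemma coords_step J (v : 'rV[R]_l) t (i : 'I_l.+1) :
  size t = l.+1 -> (i : nat) \in J -> coords Delta theta (setJ J) v = map zr t ->
  coords Delta theta (setJ J) (reflection (val (beta i)) v) =
    map zr (vsub (nth Z0 t i) t (mask_row E l.+1 J i)).
Proof.
move=> st iJ /(coordsP _ _ st) e; apply/coordsP; first by rewrite size_vsub // size_mask_row.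
move=> k; rewrite nth_vsub ?size_mask_row // nth_mkseq // zrB zrM -!e !inE iJ.
case: ifP => _; last by rewrite mulr0 subr0.
by rewrite /reflection pairingBl pairingZl hE.
Qed.

(** The search starts at the fundamental weight and only applies reflections, so it stays in the
    orbit; being closed, its result contains the orbit. *)
Lemma orbit_sizeP J k N : uniq (k :: J) -> all (fun k => k < l.+1)%N (k :: J) ->
  (size (k :: J) < l.+1)%N -> orbit_size fuel E l.+1 (k :: J) k = Some N ->
  #|subW Delta theta (setJ (k :: J))|%:R =
  #|subW Delta theta (setJ J)|%:R * zr N :> R.
Proof.
set K := k :: J => uK Kl sK; have KT := setJ_proper uK sK.
have kl : (k < l.+1)%N by case/andP: Kl.
have kK : inord k \in setJ K by rewrite inE inordK // mem_head.
rewrite -(@setJ_cons k J) //; last by case/andP: uK.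
rewrite /orbit_size; set rows := map _ K; set L := bfs _ _ _ _.
case: ifP => // /andP[uL cL] [<-]; rewrite zr_nat.
(* These products make the pairing 2 (om, beta_i) / (beta_i, beta_i) a Kronecker delta on the nodes
   of [K]. *)
have [om hom] := dual_ext htheta (fun i => (i == inord k)%:R *
  dot (val (beta i)) (val (beta i)) / 2) KT.
have om_fund i : i \in setJ K -> pairing om (val (beta i)) = (i == inord k)%:R.
  move=> iK; rewrite /pairing hom //; field.
  by rewrite dot_eq0 val_root_neq0.
have cu : coords Delta theta (setJ K) om = map zr (unitv l.+1 k).
  apply/coordsP; first exact: size_mkseq.
  move=> i; rewrite nth_mkseq //; case: ifP => [/om_fund ->|iK].
    by rewrite -val_eqE /= inordK //; case: eqP.
  by case: eqP => // ik; move: iK; rewrite inE ik mem_head.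
have su : size (unitv l.+1 k) = l.+1 by exact: size_mkseq.
pose P t := size t = l.+1 /\ exists2 z, z \in subW Delta theta (setJ K) &
    coords Delta theta (setJ K) (om *m wmx Delta z) = map zr t.
have sL t : t \in L -> P t.
  apply: (bfs_ind (P := P)); last 2 first.
  - move=> x; rewrite inE => /eqP ->; split=> //; exists 1%g; first exact: group1.
    by rewrite wmx1 mulmx1.
  - move=> x; rewrite inE => /eqP ->; split=> //; exists 1%g; first exact: group1.
    by rewrite wmx1 mulmx1.
  move=> x y [sx [z zK zx]] /mapP[r /mapP[i iK ->] ->] /=; split.
    by rewrite size_vsub // size_mask_row.
  have il : (i < l.+1)%N by exact: (allP Kl).
  have iK' : Ordinal il \in setJ K by rewrite inE.
  exists (z * refl_perm (beta (Ordinal il)))%g; first by rewrite groupM ?refl_subW.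
  have zW : z \in weyl Phi by exact: (fintype.subsetP (subW_weyl Delta theta (setJ K))).
  rewrite (mul_wmxM Delta) ?refl_weyl // mul_wmx_refl.
  by rewrite (coords_step sx _ zx).
have unitL : unitv l.+1 k \in L by apply: bfs_sub; rewrite mem_head.
clearbody L; rewrite -natrM -(size_map (map zr) L); congr _%:R.
apply: (card_subW_step htheta KT kK om_fund).
- by rewrite map_inj_uniq //; exact/inj_map/zr_inj.
- move=> z /subW_word[s sK' ->].
  (* Completeness: along a word for the group element, each letter stays inside the closed list. *)
  suff [t tL ->] : exists2 t, t \in L &
      coords Delta theta (setJ K) (om *m wmx Delta (word Delta theta s)) = map zr t.
    exact: map_f.
  elim/last_ind: s sK' => [_|s i IH].
    exists (unitv l.+1 k) => //.
    by rewrite /word big_nil wmx1 mulmx1.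
  rewrite all_rcons => /andP[iK /IH[t tL tE]].
  have iK' : (i : nat) \in K by rewrite inE in iK.
  exists (vsub (nth Z0 t i) t (mask_row E l.+1 K i)).
    move/allP: cL => /(_ t tL)/allP; apply.
    by apply/mapP; exists (i : nat, mask_row E l.+1 K i) => //; apply/mapP; exists (i : nat).
  rewrite -cats1 word_cat (mul_wmxM Delta) ?word_weyl // {2}/word big_seq1 mul_wmx_refl.
  by rewrite (coords_step _ _ tE) //; case: (sL t tL).
by move=> _ /mapP[t tL ->]; have [_ [z zK zE]] := sL t tL; exists z.
Qed.

Variable cs : seq nat.
Hypothesis hcs : forall i : 'I_l.+1, nth 0%N cs i = ext_coef c i.

(** Interpolates between the sum of x^{asc w} (no node in [J], all in [ks]) and N_J (no node in
    [ks]). *)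
Definition Jsum (J ks : seq nat) : {poly R} :=
  \sum_(w in weyl Phi | Jpositive Delta theta (setJ J) w)
    \prod_(k <- ks) (if positive Delta (w (beta (inord k))) then 'X^(nth 0%N cs k) else 1).

(** Applying [w] to the relation with coefficients c_i would give a vanishing sum of positive
    heights. *)
Lemma Jpositive_setT w : w \in weyl Phi -> ~~ Jpositive Delta theta finset.setT w.
Proof.
move=> wW; apply/negP => /forall_inP pw.
have [lam hlam] := height_exists Delta.
have := congr1 (fun v => dot lam (v *m wmx Delta w)) (ext_coef_sum htheta).
rewrite mul0mx [RHS]dotC {2}/dot mul0mx mxE mulmx_suml dot_sumr => /eqP.
have p i : 0 < dot lam (val (w (beta i))) by rewrite -(hlam _).2 pw // finset.in_setT.
rewrite psumr_eq0 => [/allP /(_ ord0 (mem_index_enum _))|i _].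
  rewrite /= -scalemxAl dotZr (mul_wmx Delta) // mulf_eq0 (gt_eqF (p _)) orbF pnatr_eq0.
  by rewrite eqn0Ngt (highest_coef_gt0 htheta).
by rewrite -scalemxAl dotZr (mul_wmx Delta) // mulr_ge0 // ltW.
Qed.

Lemma Jpositive_cons k J w : (k < l.+1)%N ->
  Jpositive Delta theta (setJ (k :: J)) w =
  Jpositive Delta theta (setJ J) w && positive Delta (w (beta (inord k))).
Proof.
move=> kl; apply/forall_inP/andP => [p|[/forall_inP p pk] i].
  split; last by apply: p; rewrite inE inordK // mem_head.
  by apply/forall_inP => i iJ; apply: p; move: iJ; rewrite !inE => ->; rewrite orbT.
move=> iK; have : (i : nat) \in k :: J by move: iK; rewrite inE.
rewrite in_cons => /orP[/eqP ik|iJ]; last by apply: p; rewrite inE.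
by have -> : i = inord k by apply/val_inj; rewrite /= inordK.
Qed.

Lemma Jsum_cons k J ks : (k < l.+1)%N ->
  Jsum J (k :: ks) = Jsum J ks + ('X^(nth 0%N cs k) - 1) * Jsum (k :: J) ks.
Proof.
move=> kl; rewrite /Jsum.
under [X in _ = _ + _ * X]eq_bigl do rewrite Jpositive_cons // andbA.
rewrite [X in _ = _ + _ * X]big_mkcondr mulr_sumr -big_split /=.
apply: eq_bigr => w _; rewrite big_cons; case: ifP => _.
  by rewrite mulrBl mul1r addrCA subrr addr0.
by rewrite mul1r mulr0 addr0.
Qed.

(** At the leaves, o = |W_J| and |W_J| N_J = |W| give M N_J = |W| (M / o); the recursion follows
    [Jsum_cons]. *)
Lemma eulP M ks J o p : uniq (J ++ ks) -> all (fun k => k < l.+1)%N (J ++ ks) ->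
  (size J < l.+1)%N -> zr o = #|subW Delta theta (setJ J)|%:R ->
  eul fuel E l.+1 cs M ks J o = Some p ->
  zr M *: Jsum J ks = #|weyl Phi|%:R *: polZ R p.
Proof.
elim: ks J o p => [|k ks IH] J o p.
  rewrite cats0 => uJ aJ sJ oE /=; case: ifP => // /Z.eqb_eq oM [<-].
  have JT := setJ_proper uJ sJ.
  have zM : zr M = zr o * zr (Z.div M o) by rewrite -zrM oM.
  rewrite -(card_Jpositive htheta JT) natrM {1}zM -oE /polZ /= cons_poly_def mul0r add0r.
  rewrite /Jsum; under eq_bigr do rewrite big_nil.
  rewrite sumr_const -[in LHS]polyC1 -polyCMn -!mul_polyC -!polyCM; congr (_%:P).
  rewrite -!mulrA; congr (_ * _); rewrite mulrC; congr (_ * _); congr (_%:R).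
  by apply: eq_card => w; rewrite !inE.
move=> uJ aJ sJ oE /=.
have kl : (k < l.+1)%N by move: aJ; rewrite all_cat /= => /and3P[].
have pu : perm_eq (J ++ k :: ks) ((k :: J) ++ ks) by exact: (permEl (perm_catCA J [:: k] ks)).
have uJ2 : uniq ((k :: J) ++ ks) by rewrite -(perm_uniq pu).
have aJ2 : all (fun k => k < l.+1)%N ((k :: J) ++ ks) by rewrite -(perm_all _ pu).
have uJ1 : uniq (J ++ ks) by case/andP: uJ2.
have aJ1 : all (fun k => k < l.+1)%N (J ++ ks) by case/andP: aJ2.
have ukJ : uniq (k :: J) by move: uJ2; rewrite cat_uniq => /and3P[].
have akJ : all (fun k => k < l.+1)%N (k :: J) by move: aJ2; rewrite all_cat => /andP[].
case Ep: (eul _ _ _ _ _ _ J _) => [q|//]; have {}Ep := IH _ _ _ uJ1 aJ1 sJ oE Ep.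
rewrite Jsum_cons // scalerDr Ep.
case: eqP => [sJn [<-]|/eqP sJn].
  rewrite [X in _ + zr M *: (_ * X)]big1 ?mulr0 ?scaler0 ?addr0 // => w /andP[wW].
  by rewrite setJ_full // (negbTE (Jpositive_setT wW)).
have skJ : (size (k :: J) < l.+1)%N by rewrite /= ltn_neqAle sJn.
case EN: (orbit_size _ _ _ _ _) => [N|//]; have {}EN := orbit_sizeP ukJ akJ skJ EN.
case Er: (eul _ _ _ _ _ _ _ _) => [r|//] [<-].
have {}Er := IH _ _ _ uJ2 aJ2 skJ _ Er.
rewrite polZ_padd polZ_pmulXn1 scalerDr scalerAr Er ?scalerAr //.
by rewrite zrM EN oE.
Qed.

Lemma gen_eulerianP M ks a f : perm_eq ks (iota 0 l.+1) ->
  eul fuel E l.+1 cs M ks [::] (Zpos 1) = Some a -> zr M != 0 ->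
  gen_eulerian Delta theta c f = (f%:R^-1 * (#|weyl Phi|%:R / zr M)) *: polZ R a.
Proof.
move=> pks Ea M0; rewrite /gen_eulerian -scalerA; congr (_ *: _).
have /= := eulP _ _ _ _ Ea.
rewrite (perm_uniq pks) iota_uniq => /(_ isT) H.
rewrite mulrC -scalerA -H ?scalerA ?mulVf ?scale1r //; last 2 first.
- by rewrite (perm_all _ pks); apply/allP => k; rewrite mem_iota.
- have -> : setJ [::] = finset.set0 by apply/setP => i; rewrite !inE.
  by rewrite imset0 gen0 cards1.
rewrite /Jsum [RHS](eq_bigl (fun w => w \in weyl Phi)) => [|w]; last first.
  by rewrite [Jpositive _ _ _ _](introT forall_inP) ?andbT // => i; rewrite inE.
apply: eq_bigr => w _; rewrite /asc.
rewrite (perm_big _ pks) -(val_enum_ord l.+1) big_map big_enum /=.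
rewrite -[LHS]/('X^_) (big_mkcond (fun i => positive Delta (w (beta i)))) /=.
elim/big_rec2: _ => [|i x y _ <-]; first by rewrite expr0.
rewrite inord_val hcs exprD; congr (_ * _).
by case: ifP.
Qed.
End Spec.

(** * Highest root and Coxeter number *)

(** Squared lengths propagate along the edges by (alpha_a, alpha_a) / (alpha_b, alpha_b) = C_ab /
    C_ba, which is compared with d_a / d_b. In the end every node must have been reached. *)
Fixpoint edges_ok (C : seq (seq Z)) (d : seq Z) (l : nat) (known : seq nat)
    (es : seq (nat * nat)) : bool :=
  let C_ i j := nth Z0 (nth [::] C i) j in
  if es is (a, b) :: es' then
    [&& b \in known, (a < l)%N, ~~ Z.eqb (C_ b a) Z0,
        Z.eqb (Z.mul (C_ a b) (nth Z0 d b)) (Z.mul (C_ b a) (nth Z0 d a)) &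
        edges_ok C d l (a :: known) es']
  else all (fun k => (k \in known) && Z.ltb Z0 (nth Z0 d k)) (iota 0 l).

Section Cartan.
Variables (R : realType) (l : nat) (Phi : rootSystem R l) (Delta : base Phi).
Variables (fuel : nat) (C : seq (seq Z)).
Local Notation zr := (zr R).
Local Notation C_ i j := (nth Z0 (nth [::] C i) j).
Local Notation alpha i := (val (Delta i)).
Hypothesis hC : forall i j : 'I_l, pairing (alpha i) (alpha j) = zr (C_ i j).

Lemma pairing_dot (a b : 'rV[R]_l) : b != 0 -> pairing a b * dot b b = 2 * dot a b.
Proof. by move=> b0; rewrite /pairing divfK // dot_eq0. Qed.

Lemma edges_okP d es known (i0 : 'I_l) : 0 < zr (nth Z0 d i0) ->
  edges_ok C d l known es ->
  (forall k : 'I_l, (k : nat) \in known ->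
    dot (alpha k) (alpha k) * zr (nth Z0 d i0) = dot (alpha i0) (alpha i0) * zr (nth Z0 d k)) ->
  all (fun k => (k < l)%N) known ->
  forall k : 'I_l,
    dot (alpha k) (alpha k) * zr (nth Z0 d i0) = dot (alpha i0) (alpha i0) * zr (nth Z0 d k)
    /\ 0 < zr (nth Z0 d k).
Proof.
move=> d0; elim: es known => [|[a b] es IH] known /=.
  move=> /allP H hk _ k; have /H/andP[kn dk] : (k : nat) \in iota 0 l by rewrite mem_iota ltn_ord.
  by split; [exact: hk|rewrite -(zr0 R) zr_lt].
case/and5P => bk al Cba e /IH{}IH hk kl; apply: IH; last by rewrite /= al.
have bl : (b < l)%N by exact: (allP kl).
move=> k; rewrite inE => /orP[/eqP ka|]; last exact: hk.
pose b' := Ordinal bl; have := hk b' bk.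
have := pairing_dot (alpha k) (val_root_neq0 (Delta b')).
have := pairing_dot (alpha b') (val_root_neq0 (Delta k)).
rewrite !hC dotC /= ka => e1 e2 e3.
have Cn : zr (C_ b a) != 0 by rewrite zr_eq0.
apply: (mulfI Cn); rewrite mulrA e1 -e2 -mulrA e3.
move/Z.eqb_eq: e => /(congr1 zr); rewrite !zrM => e.
by rewrite mulrCA e mulrCA.
Qed.

Definition rep (v : seq Z) (b : Phi) :=
  size v = l /\ val b = \sum_(i < l) zr (nth Z0 v i) *: alpha i.

Lemma pairing_rep v b (i : 'I_l) : rep v b ->
  pairing (val b) (alpha i) =
  zr (sumz (iota 0 l) (fun p => Z.mul (nth Z0 v p) (C_ p i))).
Proof.
case=> _ ->; rewrite zr_sumz /pairing dot_suml mulr_sumr mulr_suml.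
apply: eq_bigr => p _; rewrite dotZl zrM -hC /pairing; ring.
Qed.

Lemma rep_step v b (i : 'I_l) : rep v b -> rep (rstep C l i v) (refl_perm (Delta i) b).
Proof.
move=> vb; split; first exact: size_mkseq.
rewrite permE /= /reflection (pairing_rep i vb) {1}vb.2.
under [RHS]eq_bigr do rewrite nth_mkseq //.
rewrite [LHS](_ : _ = \sum_(p < l) (zr (nth Z0 v p) - (p == i)%:R *
    zr (sumz (iota 0 l) (fun p => Z.mul (nth Z0 v p) (C_ p i)))) *: alpha p).
  apply: eq_bigr => p _; congr (_ *: _); rewrite val_eqE.
  by case: eqP => [->|_]; rewrite ?mul1r ?mul0r ?subr0 ?zrB.
under [RHS]eq_bigr do rewrite scalerBl.
rewrite sumrB; congr (_ - _); rewrite (bigD1 i) //= eqxx mul1r big1 ?addr0 //.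
by move=> p /negbTE ->; rewrite mul0r scale0r.
Qed.

Lemma rep_vec_inj v v' b : rep v b -> rep v' b -> v = v'.
Proof.
case=> sv bv [sv' bv']; apply: (@eq_from_nth _ Z0); rewrite ?sv ?sv' // => i il.
apply: (@zr_inj R); apply/eqP; rewrite -subr_eq0; apply/eqP.
apply: (simple_indep Delta (fun i => zr (nth Z0 v i) - zr (nth Z0 v' i)) _ (Ordinal il)).
under eq_bigr do rewrite scalerBl.
by rewrite sumrB -bv -bv' subrr.
Qed.

Lemma rep_root_inj v b b' : rep v b -> rep v b' -> b = b'.
Proof. by case=> _ e [_ e']; apply/val_inj; rewrite e e'. Qed.

Lemma rep_unit (i : 'I_l) : rep (unitv l i) (Delta i).
Proof.
split; first exact: size_mkseq.
rewrite (bigD1 i) //= nth_mkseq // eqxx zr1 scale1r big1 ?addr0 // => p pi.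
by rewrite nth_mkseq // val_eqE (negbTE pi) scale0r.
Qed.

Lemma root_list_sound v : v \in root_list fuel C l -> exists b, rep v b.
Proof.
pose P v := exists b, rep v b.
have P0 x : x \in [seq unitv l i | i <- iota 0 l] -> P x.
  case/mapP => i; rewrite mem_iota /= add0n => il ->.
  by exists (Delta (Ordinal il)); exact: (rep_unit (Ordinal il)).
apply: (bfs_ind (P := P)) => // x y [b xb]; rewrite /rsteps => /mapP[ i].
rewrite mem_iota /= add0n => il ->.
by exists (refl_perm (Delta (Ordinal il)) b); exact: (rep_step (Ordinal il)).
Qed.

Definition kvec (k : 'I_l -> nat) : seq Z := [seq Z.of_nat (k i) | i : 'I_l].

Lemma size_kvec k : size (kvec k) = l.
Proof. by rewrite size_map size_enum_ord. Qed.

Lemma nth_kvec k (i : 'I_l) : nth Z0 (kvec k) i = Z.of_nat (k i).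
Proof. by rewrite (nth_map i) ?size_enum_ord // nth_ord_enum. Qed.

Lemma rep_kvec k (b : Phi) : val b = ncomb (val \o Delta) k -> rep (kvec k) b.
Proof.
move=> bk; split; first exact: size_kvec.
by rewrite bk; apply: eq_bigr => i _; rewrite nth_kvec zr_nat.
Qed.

(* A positive root pairs positively with some simple root of its support;
   reflecting in it lowers the height, unless the root is simple. *)
Lemma root_list_complete : closed_under (rsteps C l) (root_list fuel C l) ->
  forall k (b : Phi), val b = ncomb (val \o Delta) k -> kvec k \in root_list fuel C l.
Proof.
move=> cl k; have [n] := ubnP (\sum_i k i)%N; elim: n k => // n IH k.
rewrite ltnS => kn b bk.
have [i bi] : exists i : 'I_l, 0 < (k i)%:R * dot (val b) (alpha i).
  apply/existsP; apply: contraT; rewrite negb_exists => /forallP H.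
  have := dot_gt0 (val_root_neq0 b); rewrite {2}bk dot_sumr ltNge => /negP[].
  apply: sumr_le0 => i _; rewrite dotZr leNgt; exact: H.
have ki : (0 < k i)%N.
  by rewrite lt0n; apply: contraTneq bi => ->; rewrite mul0r ltxx.
rewrite pmulr_rgt0 ?ltr0n // in bi.
have /intrP[z hz] := root_crystallographic (valP (Delta i)) (valP b).
have z0 : (0 < z)%R.
  by rewrite -(ltr_int R) -hz divr_gt0 ?mulr_gt0 // dot_gt0 // val_root_neq0.
pose b' := refl_perm (Delta i) b.
have b'E : val b' = \sum_p ((k p)%:R - (p == i)%:R * z%:~R) *: alpha p.
  rewrite /b' permE /= /reflection hz bk.
  under [RHS]eq_bigr do rewrite scalerBl.
  rewrite sumrB; congr (_ - _); rewrite (bigD1 i) //= eqxx mul1r big1 ?addr0 //.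
  by move=> p /negbTE ->; rewrite mul0r scale0r.
case: (base_sign Delta b') => k' [] b'k'.
  have kk' p : (k' p)%:R = (k p)%:R - (p == i)%:R * z%:~R :> R.
    apply/eqP; rewrite -subr_eq0; apply/eqP.
    apply: (simple_indep Delta (fun p => (k' p)%:R - ((k p)%:R - (p == i)%:R * z%:~R))).
    by under eq_bigr do rewrite scalerBl; rewrite sumrB -b'E b'k' subrr.
  have lt' : (\sum_i k' i < n)%N.
    apply: leq_trans kn; rewrite (bigD1 i) //= [X in (_ < X)%N](bigD1 i) //=.
    rewrite -addSn leq_add //.
      by rewrite -(ltr_nat R) kk' eqxx mul1r gtrBl ltr0z.
    by apply: leq_sum => p pi; rewrite -(ler_nat R) kk' (negbTE pi) mul0r subr0.
  have /IH/(_ _ b'k') k'L := lt'.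
  have -> : kvec k = rstep C l i (kvec k').
    apply: (rep_vec_inj (rep_kvec bk)).
    have -> : b = refl_perm (Delta i) b' by rewrite /b' -permM refl_permK perm1.
    exact/rep_step/rep_kvec.
  move/allP: cl => /(_ _ k'L)/allP; apply; apply/mapP; exists (i : nat) => //.
  by rewrite mem_iota ltn_ord.
(* Here the reflected root is negative: the coefficients of [b] off [i] vanish, and [b] is the
   simple root itself. *)
have kk' p : (k' p)%:R + (k p)%:R - (p == i)%:R * z%:~R = 0 :> R.
  apply: (simple_indep Delta (fun p => (k' p)%:R + (k p)%:R - (p == i)%:R * z%:~R)).
  under eq_bigr do rewrite -addrA scalerDl.
  by rewrite big_split /= -b'E b'k' subrr.
have bE : val b = (k i)%:R *: alpha i.
  rewrite bk /ncomb (bigD1 i) //= big1 ?addr0 // => p /negbTE pi.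
  have := kk' p; rewrite pi mul0r subr0 -natrD => /eqP.
  by rewrite pnatr_eq0 addn_eq0 => /andP[_ /eqP ->]; rewrite scale0r.
have kR : (k i)%:R *: alpha i \in Defs.roots Phi by rewrite -bE; exact: valP.
have k1 : (k i)%:R = 1 :> R.
  case: (root_reduced (valP (Delta i)) kR) => // k1.
  by have : (0 : R) <= (k i)%:R by []; rewrite k1 oppr_ge0 ler10.
have -> : kvec k = unitv l i.
  apply: (rep_vec_inj (rep_kvec bk)).
  have -> : b = Delta i by apply/val_inj; rewrite bE k1 scale1r.
  exact: rep_unit.
by apply: bfs_sub; apply/mapP; exists (i : nat); rewrite // mem_iota ltn_ord.
Qed.

Definition marks_ok (cs : seq nat) :=
  let L := root_list fuel C l in
  [&& closed_under (rsteps C l) L, size cs == l, map Z.of_nat cs \in L &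
    all (fun v => all (fun k => Z.leb (Z.of_nat (nth 0%N cs k)) (nth Z0 v k)) (iota 0 l) ==>
      (v == map Z.of_nat cs)) L].

(** The vector [cs] represents a root, so [theta] dominates it coefficientwise; [theta] is in the
    list, where only [cs] itself dominates [cs]. *)
Lemma highest_marks theta c cs : is_highest_root Delta theta c -> marks_ok cs ->
  forall i, c i = nth 0%N cs i.
Proof.
move=> ht /and4P[cl /eqP scs csL /allP maxL].
have cL := root_list_complete cl ht.1.
have [b bcs] := root_list_sound csL.
have bk : val b = ncomb (val \o Delta) (fun i => nth 0%N cs i).
  rewrite bcs.2; apply: eq_bigr => i _.
  by rewrite (nth_map 0%N) ?scs // zr_nat.
have := maxL _ cL; rewrite [all _ _](_ : _ = true) /=.
  move=> /eqP e i; have := nth_kvec c i; rewrite e (nth_map 0%N) ?scs //; lia.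
apply/allP => k; rewrite mem_iota /= add0n => kl.
rewrite (nth_kvec c (Ordinal kl)); have := highest_ge ht (Ordinal kl) bk => /=; lia.
Qed.

Lemma rep_cox v b : rep v b -> rep (cox C l v) ((\prod_(i < l) refl_perm (Delta i))%g b).
Proof.
move=> vb; have -> : (\prod_(i < l) refl_perm (Delta i) =
    \prod_(i <- enum 'I_l) refl_perm (Delta i))%g by rewrite enumT [index_enum _]unlock.
rewrite /cox -val_enum_ord.
elim: (enum 'I_l) v b vb => [|i s IH] v b vb; first by rewrite big_nil perm1.
by rewrite big_cons permM; apply/IH/rep_step.
Qed.

Definition cox_fixed (k : nat) :=
  all (fun i => iter k (cox C l) (unitv l i) == unitv l i) (iota 0 l).

Definition cox_ok (h : nat) :=
  [&& (0 < h)%N, cox_fixed h & all (fun k => ~~ cox_fixed k) (iota 1 h.-1)].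

(** A power of the Coxeter element is trivial exactly when it fixes all simple roots, which is
    tested for every exponent up to [h]. *)
Lemma coxeter_numberP h : cox_ok h -> coxeter_number Delta = h.
Proof.
rewrite /cox_ok; set w := (\prod_(i < l) refl_perm (Delta i))%g.
have wW : w \in weyl Phi by apply: group_prod => i _; exact: refl_weyl.
have repw k (i : 'I_l) : rep (iter k (cox C l) (unitv l i)) ((w ^+ k)%g (Delta i)).
  elim: k => [|k IH]; first by rewrite expg0 perm1; exact: rep_unit.
  by rewrite iterS expgSr permM; exact: rep_cox.
have fixP k : cox_fixed k = ((w ^+ k)%g == 1%g).
  apply/allP/eqP => [H|wk i].
    apply: (wmx_inj (Delta := Delta)); rewrite ?groupX ?group1 // wmx1.
    apply: (mx_simple_ext (Delta := Delta)) => i.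
    rewrite mul_wmx_simple mulmx1; congr val.
    have := H i; rewrite mem_iota ltn_ord => /(_ isT)/eqP e.
    by have := repw k i; rewrite e => /rep_root_inj; apply; exact: rep_unit.
  rewrite mem_iota /= add0n => il; apply/eqP.
  have := repw k (Ordinal il); rewrite wk perm1 => /rep_vec_inj; apply.
  exact: (rep_unit (Ordinal il)).
case/and3P => h0; rewrite fixP => /eqP wh /allP nf.
rewrite /coxeter_number -/w; apply/eqP; rewrite eqn_leq.
apply/andP; split; first by apply: dvdn_leq => //; rewrite order_dvdn wh.
rewrite leqNgt; apply/negP => lt.
have : #[w]%g \in iota 1 h.-1 by rewrite mem_iota order_gt0 /= add1n prednK.
by move/nf; rewrite fixP expg_order eqxx.
Qed.
End Cartan.

(** * The exceptional types *)

Lemma gpowE (R : realType) (x y : Z) n :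
  ((zr R x +i* zr R y) ^+ n)%C =
  (zr R (gpow (x, y) n).1 +i* zr R (gpow (x, y) n).2)%C.
Proof.
elim: n => [|n IH]; first by rewrite expr0 /= zr1 zr0.
by rewrite exprS IH /gpow iterS -/(gpow (x, y) n) /gmul /= zrB zrD !zrM.
Qed.

(** Clears denominators: -i (i p + h / 2 - j) = (2 p - i (h - 2 j)) / 2. *)
Lemma line_coef_sum (R : realType) (l h : nat) (k : R) (a : seq Z) (p : Z) :
  line_coef l h (k *: polZ R a) l (zr R p) =
  k / 2 ^+ l * zr R (line_sum a h l p).
Proof.
have ReZ (x : R) (w : R[i]) : complex.Re (x%:C%C * w) = x * complex.Re w.
  by case: w => u v; rewrite /= mul0r subr0.
have base (j : nat) : - 'i%C * ('i%C * (zr R p)%:C%C + (h%:R / 2 - j%:R)%:C%C) =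
    (2^-1)%:C%C * (zr R (Z.mul (Zpos 2) p) +i* zr R (Z.sub (Z.of_nat j.*2) (Z.of_nat h)))%C.
  rewrite zrM zrB !zr_nat -muln2 natrM (zr_nat R 2); apply/eqP; rewrite eq_complex /=.
  by apply/andP; split; apply/eqP; field.
rewrite /line_coef mulr_sumr raddf_sum /line_sum zr_sumz mulr_sumr.
apply: eq_bigr => j _; rewrite mulrCA -exprMn base exprMn gpowE /=.
rewrite ReZ (_ : (2^-1)%:C%C ^+ l = (2^-1 ^+ l)%:C%C :> R[i]); last by rewrite rmorphXn.
rewrite ReZ /= coefZ coef_Poly.
rewrite zrM exprVn; case: (ltnP j (size a)) => ja.
  by rewrite (nth_map Z0) //; ring.
by rewrite !nth_default ?size_map // zr0; ring.
Qed.

Section ExtCartan.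
Variables (R : realType) (X : exceptional) (Phi : rootSystem R (rank_of X)).
Variable Delta : base Phi.
Hypothesis hX : has_type Delta.
Local Notation l := (rank_of X).
Local Notation zr := (zr R).
Local Notation alpha i := (val (Delta i)).

Lemma cartZ_pairing (i j : 'I_l) :
  pairing (alpha i) (alpha j) = zr (nth Z0 (nth [::] (cartZ X) i) j).
Proof.
rewrite hX /cartZ mxE -zr_of_int; congr zr.
have si : size (cartan_rows X) = l by case: (X).
have /allP rows : all (fun i => size (nth [::] (cartan_rows X) i) == l) (iota 0 l).
  by case: (X).
have /rows/eqP ri : (i : nat) \in iota 0 l by rewrite mem_iota ltn_ord.
by rewrite (nth_map [::]) ?si // (nth_map 0) ?ri.
Qed.

Definition ext_cartan_ok :=
  [&& Z.ltb Z0 (theta_half_len X),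
    Z.eqb (Z.mul (Zpos 2) (theta_half_len X)) (sumz (iota 0 l) (fun k =>
      Z.mul (Z.of_nat (nth 0%N (marks X) k))
       (Z.mul (nth Z0 (half_len X) k) (nth Z0 (theta_pairing X) k)))) &
    all (fun k => Z.eqb (Z.mul (nth Z0 (nth [::] (ext_cartan X) k.+1) 0) (theta_half_len X))
      (Z.opp (Z.mul (nth Z0 (half_len X) k) (nth Z0 (theta_pairing X) k)))) (iota 0 l)].

Lemma ext_cartanP theta c : is_highest_root Delta theta c ->
  (forall i, c i = nth 0%N (marks X) i) ->
  edges_ok (cartZ X) (half_len X) l [:: 0%N] (dynkin_edges X) ->
  ext_cartan_ok ->
  forall i k : 'I_l.+1,
    pairing (val (ext_root Delta theta i)) (val (ext_root Delta theta k)) =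
    zr (nth Z0 (nth [::] (ext_cartan X) i) k).
Proof.
move=> ht hc eok /and3P[thl0 /Z.eqb_eq thl /allP ek].
have l0 : (0 < l)%N by case: (X).
pose i0 := Ordinal l0.
have d0 : 0 < zr (nth Z0 (half_len X) i0) by rewrite -(zr0 R) zr_lt -[nat_of_ord i0]/0%N; case: (X).
have len := edges_okP cartZ_pairing d0 eok.
(* The scale between the inner product of [Phi] and [half_len]: (alpha_k, alpha_k) = 2 kap d_k, with
   the same kap for all k. *)
pose kap := dot (alpha i0) (alpha i0) / zr (nth Z0 (half_len X) i0) / 2.
have kap0 : 0 < kap by rewrite !divr_gt0 // dot_gt0 // val_root_neq0.
have {}len (k : 'I_l) : dot (alpha k) (alpha k) = 2 * kap * zr (nth Z0 (half_len X) k).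
  have [||e _] := len _ _ k.
  - by move=> p; rewrite inE => /eqP p0; have -> : p = i0 by exact/val_inj.
  - by rewrite /= l0.
  by apply: (mulIf (lt0r_neq0 d0)); rewrite e /kap; field; rewrite lt0r_neq0.
have tp (k : 'I_l) : pairing (val theta) (alpha k) = zr (nth Z0 (theta_pairing X) k).
  rewrite nth_mkseq // zr_sumz ht.1 /pairing dot_suml mulr_sumr mulr_suml.
  apply: eq_bigr => i _; rewrite dotZl zrM zr_nat hc -cartZ_pairing /pairing /=; ring.
have tdot (k : 'I_l) : dot (val theta) (alpha k) =
    kap * (zr (nth Z0 (half_len X) k) * zr (nth Z0 (theta_pairing X) k)).
  have := pairing_dot (val theta) (val_root_neq0 (Delta k)); rewrite tp len => e.
  have n2 : (2 : R) != 0 by rewrite pnatr_eq0.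
  by apply: (mulfI n2); rewrite -e; ring.
have tt : dot (val theta) (val theta) = 2 * kap * zr (theta_half_len X).
  rewrite {2}ht.1 dot_sumr.
  under eq_bigr do rewrite dotZr tdot mulrCA.
  rewrite -mulr_sumr -[RHS]mulrA [RHS]mulrCA; congr (_ * _).
  have -> : 2 * zr (theta_half_len X) = zr (Z.mul (Zpos 2) (theta_half_len X)).
    by rewrite zrM (zr_nat R 2).
  rewrite thl zr_sumz; apply: eq_bigr => k _.
  by rewrite !zrM zr_nat hc.
have thlR : 0 < zr (theta_half_len X) by rewrite -(zr0 R) zr_lt.
have tc (k : 'I_l) : - pairing (alpha k) (val theta) =
    zr (nth Z0 (nth [::] (ext_cartan X) k.+1) 0).
  apply: (mulIf (lt0r_neq0 thlR)); rewrite -zrM.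
  have /ek/Z.eqb_eq -> : (k : nat) \in iota 0 l by rewrite mem_iota ltn_ord.
  rewrite zrN zrM /pairing tt dotC tdot; field.
  by rewrite !lt0r_neq0.
have pNl (u v : 'rV[R]_l) : pairing (- u) v = - pairing u v.
  by rewrite /pairing dotNl mulrN mulNr.
have pNr (u v : 'rV[R]_l) : pairing u (- v) = - pairing u v.
  by rewrite /pairing !dotNr dotNl opprK mulrN mulNr.
have sC : size (cartZ X) = l by case: (X).
move=> i k; case: (unliftP ord0 i) => [i' ->|->]; case: (unliftP ord0 k) => [k' ->|->].
- rewrite !ext_rootS cartZ_pairing !lift0 /ext_cartan.
  by rewrite /= nth_mkseq.
- by rewrite ext_rootS ext_root0 lift0 /= pNr tc.
- rewrite ext_rootS ext_root0 lift0 /= pNl tp (nth_map Z0) ?zrN //.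
  by rewrite size_mkseq.
rewrite ext_root0 /= pNl pNr opprK /pairing mulfK ?dot_eq0 ?val_root_neq0 //.
Qed.
End ExtCartan.

Definition euler_ok (X : exceptional) : bool :=
  let h := cox_num X in let l := rank_of X in
  if eulZ X is Some a then
    [&& (size a <= h.+1)%N,
        all (fun i => Z.eqb (nth Z0 a i) (nth Z0 a (h - i))) (iota 0 h.+1) &
        if sample_points X is p :: ps then (size ps == l) &&
          path (fun p q => Z.ltb p q && Z.ltb (Z.mul (line_sum a h l p) (line_sum a h l q)) Z0) p ps
        else false]
  else false.

Lemma exceptional_ok (X : exceptional) :
  [&& edges_ok (cartZ X) (half_len X) (rank_of X) [:: 0%N] (dynkin_edges X),
      ext_cartan_ok X, marks_ok (rank_of X) 100 (cartZ X) (marks X),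
      cox_ok (rank_of X) (cartZ X) (cox_num X) & euler_ok X].
Proof. by case: X; vm_compute. Qed.

(** The coset of 0 exists. The point matters because the inverse of 0 is 0 by convention, which
    would annihilate R_Phi. *)
Lemma index_of_connection_neq0 (R : realType) (l : nat) (Phi : rootSystem R l) f :
  is_index_of_connection Phi f -> f != 0%N.
Proof.
move=> hf; apply/negP => /eqP f0; move: hf; rewrite /is_index_of_connection f0 II0.
rewrite card_eq0 => /eqP e0.
have : (([set ((fun q => (v + q)%R) @` coroot_lattice Phi)
     | v in coweight_lattice Phi]) ((fun q => (0 + q)%R) @` coroot_lattice Phi))%classic.
  exists 0 => // a; rewrite /dot mul0mx mxE; exact: rpred0.
by rewrite e0.
Qed.

Unset Implicit Arguments.

Theorem theorem4p1 (R : realType) (X : exceptional)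
  (Phi : rootSystem R (rank_of X)) (Delta : base Phi)
  (hX : has_type Delta)
  (theta : Phi) (c : 'I_(rank_of X) -> nat)
  (htheta : is_highest_root Delta theta c)
  (f : nat) (hf : is_index_of_connection Phi f)
  (h : nat) (hh : h = coxeter_number Delta)
  (g : {poly R}) (hdeg : size g = (rank_of X).+1)
  (hsym : forall t : R, g.[t - h%:R] = (-1) ^+ rank_of X * g.[- t]) :
  exists m1 : nat, forall m : nat, (m1 <= m)%N ->
    forall alpha : R[i],
      shift_op
        (map_poly (real_complex R) (gen_eulerian Delta theta c f) \Po 'X^(m.+1))
        (horner (map_poly (real_complex R) g)) alpha = 0 ->
      complex.Re alpha = m%:R * h%:R / 2.
Proof.
have /and5P[edges extok marksok coxok] := exceptional_ok X.
rewrite /euler_ok; case Ea: (eulZ X) => [a|//] /and3P[sa /allP pal].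
case: (sample_points X) => [//|p ps] /andP[/eqP sps pathp].
have hC := cartZ_pairing hX.
have hh' : h = cox_num X by rewrite hh; exact: (coxeter_numberP hC coxok).
have hc := highest_marks hC htheta marksok.
have hE := ext_cartanP hX htheta hc edges extok.
have hcs (i : 'I_(rank_of X).+1) : nth 0%N (1%N :: marks X) i = ext_coef c i.
  by rewrite /ext_coef; case: (unliftP ord0 i) => [j ->|->].
have M0 : zr R (weyl_order X) != 0 by rewrite zr_eq0; case: (X).
have pks : perm_eq (rcons (iota 1 (rank_of X)) 0%N) (iota 0 (rank_of X).+1).
  by rewrite perm_rcons.
have := gen_eulerianP htheta hE hcs f pks Ea M0.
(* The scalar between R_Phi and the computed integer polynomial; being nonzero, it affects neither
   palindromy nor sign changes. *)
set k := (_ * _); move=> ->.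
have k0 : k != 0.
  rewrite !mulf_neq0 ?invr_eq0 ?pnatr_eq0 ?(index_of_connection_neq0 hf) //.
  by rewrite -lt0n cardG_gt0.
have coefA i : (k *: polZ R a)`_i = k * zr R (nth Z0 a i).
  rewrite coefZ coef_Poly; case: (ltnP i (size a)) => ia; first by rewrite (nth_map Z0).
  by rewrite !nth_default ?size_map // mulr0.
apply: (@roots_on_line R (rank_of X) h (k *: polZ R a) g hdeg hsym _ _
  (zr R p) (map (zr R) ps)).
- apply: leq_trans (size_scale_leq _ _) _; apply: leq_trans (size_Poly _) _.
  by rewrite size_map hh'.
- move=> i ih; rewrite !coefA; congr (_ * zr R _).
  by apply/Z.eqb_eq; rewrite hh'; apply: pal; rewrite mem_iota /= add0n ltnS -hh'.
- by case: (X).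
- by rewrite size_map.
rewrite path_map; apply: sub_path pathp => x y /= /andP[xy sxy].
rewrite zr_lt xy /= !line_coef_sum mulrACA -zrM hh'.
(* The two values share the factor k / 2^l, which enters their product as a positive square. *)
rewrite pmulr_rlt0 ?zr_lt0 //.
by rewrite -expr2 exprn_even_gt0 //= mulf_neq0 // invr_eq0 expf_neq0 // pnatr_eq0.
Qed.
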